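(* Let $\mathcal{A}=\{A_1,\dots,A_n\}$ be a finite irreducible family of real $d\times d$ matrices, let $m>0$, and consider the continuous-time linear switching system $\dot{\boldsymbol{x}}(t)=A(t)\boldsymbol{x}(t)$, $A(t)\in\mathcal{A}$, $t\ge 0$, with dwell time constraint $m$. Let $\sigma(\mathcal{A})$ be its Lyapunov exponent. For each discretization step $h>0$, let $\mathcal{A}_h$ be the $h$-discretization, let $\hat\rho(\mathcal{A}_h)$ be its (Markovian) joint spectral radius, put $\sigma_h=\ln\hat\rho(\mathcal{A}_h)$, let $\|\cdot\|=\{\|\cdot\|_j\}_{j=1}^n$ be an extremal multinorm of $\mathcal{A}_h$ (depending on $h$), and put $\|(\mathcal{A}-\sigma_h I)^2\|=\max_{j=1,\dots,n}\|(A_j-\sigma_h I)^2\|_j$. Then $$\sigma_h\ \le\ \sigma(\mathcal{A})\ \le\ \sigma_h+\frac{\|(\mathcal{A}-\sigma_h I)^2\|}{8m}\,h^2+\mathcal{O}(h^4)\qquad\text{as } h\to 0 .$$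
   Context: Switching system with dwell time $m$. The control set $\mathcal{A}=\{A_1,\dots,A_n\}$ is a finite set of real $d\times d$ matrices. A switching law is a piecewise constant function $A:[0,+\infty)\to\mathcal{A}$ all of whose stationary (switching) intervals have length at least $m$, where $m>0$ is fixed. A trajectory is a solution $\boldsymbol{x}:[0,\infty)\to\mathbb{R}^d$ of $\dot{\boldsymbol{x}}(t)=A(t)\boldsymbol{x}(t)$ for some such switching law and some initial point $\boldsymbol{x}(0)\in\mathbb{R}^d$. Lyapunov exponent. $\sigma(\mathcal{A})$ is the infimum of the numbers $\alpha$ such that every trajectory satisfies $\|\boldsymbol{x}(t)\|\le Ce^{\alpha t}$ for all $t\ge 0$, with some constant $C=C(\boldsymbol{x})$. Irreducibility. $\mathcal{A}$ is irreducible if the matrices of $\mathcal{A}$ have no common invariant linear subspace other than $\{0\}$ and $\mathbb{R}^d$. $h$-discretization $\mathcal{A}_h$. It is the following dynamical system on the complete directed graph (with loops) on $n$ vertices. To each vertex $j\in\{1,\dots,n\}$ is attached the space $V_j=\mathbb{R}^d$. To each ordered pair $(i,j)$ is attached an edge from $i$ to $j$ with a linear operator $E_{ji}:V_i\to V_j$ and a time of action $h_{ji}>0$, namely $E_{jj}=e^{hA_j}$, $h_{jj}=h$, and $E_{ji}=e^{mA_j}$, $h_{ji}=m$ for $i\ne j$. A trajectory of $\mathcal{A}_h$ is given by a sequence of vertices $i_0,i_1,i_2,\dots$ (arbitrary elements of $\{1,\dots,n\}$) and a point $\boldsymbol{x}_0\in V_{i_0}$, with $\boldsymbol{x}_{k+1}=E_{i_{k+1}i_k}\boldsymbol{x}_k\in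 V_{i_{k+1}}$; the point $\boldsymbol{x}_k$ corresponds to the time $t_k=\sum_{s=1}^k h_{i_s i_{s-1}}$. Multinorm. A multinorm is a collection of norms $\{\|\cdot\|_j\}_{j=1}^n$, with $\|\cdot\|_j$ a norm on $V_j$; one writes $\|\boldsymbol{x}\|=\|\boldsymbol{x}\|_j$ for $\boldsymbol{x}\in V_j$. For a matrix $X$, $\|X\|_j$ is the operator norm of $X$ induced by $\|\cdot\|_j$. Joint spectral radius. $\hat\rho(\mathcal{A}_h)=\lim_{k\to\infty}\max\|\boldsymbol{x}_k\|^{1/t_k}$, where the maximum is over all trajectories $\{\boldsymbol{x}_s\}_{s=0}^k$ of $\mathcal{A}_h$ with $\|\boldsymbol{x}_0\|=1$ (the limit exists and does not depend on the multinorm). Extremal multinorm. A multinorm is extremal for $\mathcal{A}_h$ if $\|E_{ji}\boldsymbol{x}\|_j\le \hat\rho(\mathcal{A}_h)^{h_{ji}}\|\boldsymbol{x}\|_i$ for all $i,j\in\{1,\dots,n\}$ and all $\boldsymbol{x}\in V_i$. $I$ is the identity matrix. The family $\mathcal{A}$ and the dwell time $m$ are fixed as $h\to 0$. *)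

(* Defs.v *)
From mathcomp Require Import all_boot all_order all_algebra.
From mathcomp Require Import all_classical all_reals all_analysis.
Set Implicit Arguments.
Unset Strict Implicit.
Unset Printing Implicit Defensive.
Import Order.TTheory GRing.Theory Num.Theory.
Import numFieldNormedType.Exports.
Local Open Scope classical_set_scope.
Local Open Scope ring_scope.

Definition mexp (R : realType) (d : nat) (X : 'M[R]_d) : 'M[R]_d :=
  limn (series (fun k : nat => (k`!%:R)^-1 *: X ^+ k)).

Definition irreducible_family (R : realType) (d n : nat)
    (A : 'I_n -> 'M[R]_d) : Prop :=
  forall U : {vspace 'cV[R]_d},
    (forall (j : 'I_n) (x : 'cV[R]_d), x \in U -> A j *m x \in U) ->
    U = 0%VS \/ U = fullv.

(* [tau] lists the end points of the stationary intervals.  Consecutive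
   intervals may carry the same matrix, so a law with finitely many switchings
   is covered by cutting its last, infinite, interval into pieces of length
   [m].  The values of [S] at negative times are irrelevant. *)
Definition switching_law (R : realType) (d n : nat) (A : 'I_n -> 'M[R]_d)
    (m : R) (tau : nat -> R) (S : R -> 'M[R]_d) : Prop :=
  [/\ tau 0%N = 0,
      forall k : nat, tau k + m <= tau k.+1 &
      forall k : nat, exists j : 'I_n,
        forall t : R, tau k <= t < tau k.+1 -> S t = A j].

(* A solution is continuous on [0, +oo[ and satisfies the equation at every
   positive time that is not a switching time. *)
Definition trajectory (R : realType) (d n : nat) (A : 'I_n -> 'M[R]_d)
    (m : R) (x : R -> 'cV[R]_d) : Prop :=
  exists (tau : nat -> R) (S : R -> 'M[R]_d),
    [/\ switching_law A m tau S,
        {within `[0, +oo[, continuous x} &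
        forall (k : nat) (t : R), tau k < t < tau k.+1 ->
          is_derive t 1 x (S t *m x t)].

Definition lyapunov_exponent (R : realType) (d n : nat)
    (A : 'I_n -> 'M[R]_d) (m : R) : R :=
  inf [set alpha : R | forall x : R -> 'cV[R]_d, trajectory A m x ->
    exists C : R, forall t : R, 0 <= t -> `|x t| <= C * expR (alpha * t)].

(* As in [E_{ji}] and [h_{ji}], the target vertex comes first. *)
Definition edge_op (R : realType) (d n : nat) (A : 'I_n -> 'M[R]_d) (m h : R)
    (j i : 'I_n) : 'M[R]_d :=
  if j == i then mexp (h *: A j) else mexp (m *: A j).

Definition edge_time (R : realType) (n : nat) (m h : R) (j i : 'I_n) : R :=
  if j == i then h else m.

(* Every finite trajectory is an initial segment of an infinite one. *)
Definition discrete_trajectory (R : realType) (d n : nat)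
    (A : 'I_n -> 'M[R]_d) (m h : R) (v : nat -> 'I_n) (x : nat -> 'cV[R]_d) :
    Prop :=
  forall k : nat, x k.+1 = edge_op A m h (v k.+1) (v k) *m x k.

Definition path_time (R : realType) (n : nat) (m h : R) (v : nat -> 'I_n)
    (k : nat) : R :=
  \sum_(s < k) edge_time m h (v s.+1) (v s).

Definition is_norm (R : realType) (d : nat) (N : 'cV[R]_d -> R) : Prop :=
  [/\ forall x y, N (x + y) <= N x + N y,
      forall (a : R) x, N (a *: x) = `|a| * N x &
      forall x, N x = 0 -> x = 0].

Definition is_multinorm (R : realType) (d n : nat)
    (N : 'I_n -> 'cV[R]_d -> R) : Prop :=
  forall j : 'I_n, is_norm (N j).

(* For [h > 0] the supremum is a maximum: finitely many vertex sequences matter,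
   and the initial point ranges over compact unit spheres. *)
Definition jsr_seq (R : realType) (d n : nat) (A : 'I_n -> 'M[R]_d) (m h : R)
    (N : 'I_n -> 'cV[R]_d -> R) (k : nat) : R :=
  sup [set r : R | exists (v : nat -> 'I_n) (x : nat -> 'cV[R]_d),
    [/\ discrete_trajectory A m h v x, N (v 0%N) (x 0%N) = 1 &
        r = N (v k) (x k) `^ (path_time m h v k)^-1]].

(* The limit is the same for all multinorms; it is computed here with the
   max norm of ['cV[R]_d] at every vertex. *)
Definition joint_spectral_radius (R : realType) (d n : nat)
    (A : 'I_n -> 'M[R]_d) (m h : R) : R :=
  limn (jsr_seq A m h (fun _ x => `|x|)).

Definition sigma_discr (R : realType) (d n : nat) (A : 'I_n -> 'M[R]_d)
    (m h : R) : R :=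
  ln (joint_spectral_radius A m h).

Definition extremal_multinorm (R : realType) (d n : nat)
    (A : 'I_n -> 'M[R]_d) (m h : R) (N : 'I_n -> 'cV[R]_d -> R) : Prop :=
  is_multinorm N /\
  forall (i j : 'I_n) (x : 'cV[R]_d),
    N j (edge_op A m h j i *m x) <=
      joint_spectral_radius A m h `^ edge_time m h j i * N i x.

Definition op_norm (R : realType) (d : nat) (N : 'cV[R]_d -> R)
    (X : 'M[R]_d) : R :=
  sup [set N (X *m x) | x in [set x : 'cV[R]_d | N x = 1]].

(* Operator norms are nonnegative, so the default value [0] of the iterated
   maximum only matters when [n = 0]. *)
Definition shifted_square_norm (R : realType) (d n : nat)
    (A : 'I_n -> 'M[R]_d) (s : R) (N : 'I_n -> 'cV[R]_d -> R) : R :=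
  \big[Num.max/0]_(j < n) op_norm (N j) ((A j - s%:M) ^+ 2).

(* Main.v *)
Require Import Defs.
From HB Require Import structures.
From mathcomp Require Import all_boot all_order all_algebra.
From mathcomp Require Import all_classical all_reals all_analysis.
From mathcomp Require Import ring lra.
Set Implicit Arguments.
Unset Strict Implicit.
Unset Printing Implicit Defensive.
Import Order.TTheory GRing.Theory Num.Theory.
Import numFieldNormedType.Exports.
Local Open Scope classical_set_scope.
Local Open Scope ring_scope.

(** Why the estimate holds.

    Lower bound.  By [jsr_growth], [sigma_discr A m h] lies below every exponent
    [s] for which all trajectories of the discretization satisfy
    [|x_k| <= C exp (s t_k) |x_0|] with one constant [C].  After a preliminary
    stay of length [m], a discrete trajectory samples a trajectory of the
    switching system ([discrete_word]).  The constants in the definition of the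
    Lyapunov exponent depend on the trajectory, but they can be made uniform:
    otherwise ever worse finite switching laws could be concatenated into one law
    that violates the bound ([word_uniform_bound]).

    Upper bound.  Put [s = sigma_discr A m h], [B_j = A_j - s], and let [K] bound
    [B_j ^ 2] in the extremal norm at [j].  On a stay at [j] the curve
    [y (t) = exp (t B_j) x] solves [y'' = B_j ^ 2 y].  Extremality says that the
    norm of [y] does not exceed its initial value at the points of the grid; if
    [M] is its maximum between two such points, then linear interpolation has an
    error of at most [K M h ^ 2 / 8], so that [M (1 - q) <= N x] with
    [q = K h ^ 2 / 8] ([interpolation_bound]).  A stay thus costs a factor
    [1 / (1 - q)], and there are at most [t / m] complete stays up to the time
    [t]; hence the exponent [s + (q + 2 q ^ 2) / m] is admissible
    ([extremal_trajectory_growth]).  Here [q / m] is the announced term of second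
    order and [2 q ^ 2 / m] is the remainder.

    The remainder is of fourth order because [K] stays bounded as [h] tends to
    zero ([extremal_curvature_bounded]).  If it did not, normalized extremal norms
    would degenerate on some unit vectors.  Their limit along an ultrafilter is a
    family of seminorms, not all zero, which the flows of the [A_j] and the jumps
    of length [m] multiply by bounded factors; therefore all its seminorms have
    the same kernel, a common invariant subspace of the [A_j]
    ([limit_kernel_trivial]).  It contains a nonzero vector and is not the whole
    space, which contradicts irreducibility. *)

(** * Norms of matrices and the matrix exponential *)

Lemma normmx_ge_entry (R : realType) (p q : nat) (X : 'M[R]_(p, q)) i j :
  `|X i j| <= `|X|.
Proof.
by rewrite [leRHS]/Num.Def.normr /= mx_normrE; exact: (le_bigmax _ _ (i, j)).
Qed.

Lemma normmx_le (R : realType) (p q : nat) (X : 'M[R]_(p, q)) (c : R) :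
  0 <= c -> (forall i j, `|X i j| <= c) -> `|X| <= c.
Proof.
move=> c0 Xc; rewrite [leLHS]/Num.Def.normr /= mx_normrE.
by apply: bigmax_le => // -[i j] _; exact: Xc.
Qed.

Lemma normmx_mul (R : realType) (p q r : nat) (X : 'M[R]_(p, q))
    (Y : 'M[R]_(q, r)) : `|X *m Y| <= q%:R * `|X| * `|Y|.
Proof.
apply: normmx_le => [|i j]; first by rewrite !mulr_ge0.
rewrite mxE (le_trans (ler_norm_sum _ _ _))//.
have -> : q%:R * `|X| * `|Y| = \sum_(k < q) `|X| * `|Y|.
  by rewrite sumr_const card_ord -mulrA mulr_natl.
apply: ler_sum => k _.
by rewrite normrM ler_pM// normmx_ge_entry.
Qed.

Definition acts_below (R : realType) (d : nat) (X : 'M[R]_d) (c : R) : Prop :=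
  forall x : 'cV[R]_d, `|X *m x| <= c * `|x|.

Lemma cvg_mxE (R : realType) (T : Type) (F : set_system T) (p q : nat)
    (f : T -> 'M[R]_(p, q)) (X : 'M[R]_(p, q)) i j :
  Filter F -> f @ F --> X -> (fun t => f t i j) @ F --> X i j.
Proof.
move=> FF fX; apply: (@cvg_comp _ _ _ f (fun Y : 'M[R]_(p, q) => Y i j) _ _ _ fX).
exact: coord_continuous.
Qed.

Lemma cvg_mx_entries (R : realType) (T : Type) (F : set_system T) (p q : nat)
    (f : T -> 'M[R]_(p, q)) (X : 'M[R]_(p, q)) :
  Filter F -> (forall i j, (fun t => f t i j) @ F --> X i j) -> f @ F --> X.
Proof.
move=> FF fX; apply/cvgrPdist_le => e e0.
have : \forall t \near F, forall i j, `|X i j - f t i j| <= e.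
  apply: filter_forall => i; apply: filter_forall => j.
  by move/cvgrPdist_le : (fX i j); exact.
apply: filterS => t Xt; apply: normmx_le => [|i j]; first exact: ltW.
by rewrite !mxE.
Qed.

Lemma cvg_mulmx (R : realType) (T : Type) (F : set_system T) (p q r : nat)
    (f : T -> 'M[R]_(p, q)) (g : T -> 'M[R]_(q, r)) (X : 'M[R]_(p, q))
    (Y : 'M[R]_(q, r)) :
  Filter F -> f @ F --> X -> g @ F --> Y ->
  (fun t => f t *m g t) @ F --> X *m Y.
Proof.
move=> FF fX gY; apply: cvg_mx_entries => i j; rewrite mxE.
have -> : (fun t => (f t *m g t) i j) = fun t => \sum_k f t i k * g t k j.
  by apply/funext => t; rewrite mxE.
by apply: cvg_big => [|k _]; [exact: add_continuous|apply: cvgM; exact: cvg_mxE].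
Qed.

Lemma unit_vector_exists (R : realType) (d : nat) :
  (0 < d)%N -> exists x : 'cV[R]_d, `|x| = 1.
Proof.
move=> d0; exists (const_mx 1); apply/eqP; rewrite eq_le; apply/andP; split.
  by apply: normmx_le => // i j; rewrite mxE normr1.
have := @normmx_ge_entry _ _ _ (const_mx 1 : 'cV[R]_d) (Ordinal d0) 0.
by rewrite mxE normr1.
Qed.

Lemma scalemx_expr (R : comPzRingType) (d : nat) (a : R) (X : 'M[R]_d) k :
  (a *: X) ^+ k = a ^+ k *: X ^+ k.
Proof.
elim: k => [|k IHk]; first by rewrite !expr0 scale1r.
by rewrite !exprS IHk -mulmxE -scalemxAl -scalemxAr scalerA.
Qed.

Lemma normmx_expr (R : realType) (d : nat) (X : 'M[R]_d) k :
  `|X ^+ k| <= (d%:R * `|X|) ^+ k.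
Proof.
elim: k => [|k IHk].
  rewrite !expr0; apply: normmx_le => // i j.
  by rewrite mxE; case: (_ == _); rewrite ?normr1 ?normr0.
rewrite !exprS (le_trans (normmx_mul _ _))// ler_wpM2l// mulr_ge0.
Qed.

(* Completeness and the norm have to be joined before absolutely convergent
   series of matrices can be summed. *)
HB.instance Definition _ (R : realType) (p q : nat) :=
  Complete.on 'M[R]_(p, q).

Lemma cvg_mexp (R : realType) (d : nat) (X : 'M[R]_d) :
  series (fun k : nat => (k`!%:R)^-1 *: X ^+ k) @ \oo --> mexp X.
Proof.
rewrite /mexp; apply: normed_cvg.
apply: (@series_le_cvg _ _ (exp_coeff (d%:R * `|X|))).
- by move=> n /=.
- by move=> n; rewrite /exp_coeff /= mulr_ge0// ?exprn_ge0// mulr_ge0.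
- move=> n /=; rewrite normrZ /exp_coeff /= mulrC ger0_norm ?invr_ge0//.
  by rewrite ler_wpM2r ?invr_ge0// normmx_expr.
- exact: is_cvg_series_exp_coeff.
Qed.

Arguments cvg_mexp {R d} X.

Lemma acts_below_norm (R : realType) (d : nat) (X : 'M[R]_d) :
  acts_below X (d%:R * `|X|).
Proof. by move=> x; exact: normmx_mul. Qed.

Lemma acts_below_expr (R : realType) (d : nat) (X : 'M[R]_d) (c : R) k :
  0 <= c -> acts_below X c -> acts_below (X ^+ k) (c ^+ k).
Proof.
move=> c0 Xc x; elim: k => [|k IHk]; first by rewrite !expr0 mul1mx mul1r.
rewrite !exprS -mulmxE -mulmxA (le_trans (Xc _))// -mulrA.
by rewrite ler_wpM2l.
Qed.

Lemma exp_coeff_sum_le (R : realType) (c : R) n :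
  0 <= c -> \sum_(0 <= k < n) exp_coeff c k <= expR c.
Proof.
move=> c0; apply: (nondecreasing_cvgn_le _ (is_cvg_series_exp_coeff c) n).
by apply: nondecreasing_series => k _ _; rewrite /exp_coeff/= divr_ge0// exprn_ge0.
Qed.

Lemma mexp_taylor (R : realType) (d : nat) (X : 'M[R]_d) (c : R) K
    (x : 'cV[R]_d) : 0 <= c -> acts_below X c ->
  `|mexp X *m x - \sum_(0 <= k < K) (k`!%:R)^-1 *: (X ^+ k *m x)|
    <= c ^+ K * expR c * `|x|.
Proof.
move=> c0 Xc; set S := \sum_(0 <= k < K) _.
set u := series (fun k : nat => (k`!%:R)^-1 *: X ^+ k).
have uE n : u n *m x = \sum_(0 <= k < n) (k`!%:R)^-1 *: (X ^+ k *m x).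
  rewrite /u /series /= mulmx_suml; apply: eq_bigr => k _.
  by rewrite scalemxAl.
have ucvg : (fun n => `|u n *m x - S|) @ \oo --> `|mexp X *m x - S|.
  apply: cvg_norm; apply: cvgB; last exact: cvg_cst.
  by apply: cvg_mulmx; [exact: cvg_mexp|exact: cvg_cst].
rewrite -(cvg_lim _ ucvg)//; apply: limr_le; 
  first by apply/cvg_ex; eexists; exact: ucvg.
near=> n; have Kn : (K <= n)%N by near: n; exact: nbhs_infty_ge.
rewrite uE /S (big_cat_nat (n := K))//= addrAC subrr add0r.
rewrite -[in leLHS](add0n K) big_addn (le_trans (ler_norm_sum _ _ _))//.
apply: (@le_trans _ _ (\sum_(0 <= j < n - K) c ^+ K * exp_coeff c j * `|x|)).
  apply: ler_sum => j _; rewrite normrZ ger0_norm ?invr_ge0//.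
  rewrite (le_trans (ler_wpM2l _ (acts_below_expr _ c0 Xc _)))// ?invr_ge0//.
  rewrite (_ : _ * _ * `|x| = (c ^+ (j + K) * `|x|) * (j`!%:R)^-1); last first.
    by rewrite exprD /exp_coeff/=; ring.
  rewrite mulrC ler_wpM2l ?mulr_ge0 ?exprn_ge0//.
  by rewrite lef_pV2 ?posrE ?ltr0n ?fact_gt0// ler_nat leq_fact// leq_addr.
rewrite -mulr_suml -mulr_sumr ler_wpM2r// ler_wpM2l ?exprn_ge0//.
exact: exp_coeff_sum_le.
Unshelve. all: by end_near. Qed.

Lemma mexp_acts_below (R : realType) (d : nat) (X : 'M[R]_d) (c : R) :
  0 <= c -> acts_below X c -> acts_below (mexp X) (expR c).
Proof.
move=> c0 Xc x; have := mexp_taylor 0 x c0 Xc.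
by rewrite big_geq// subr0 expr0 mul1r.
Qed.

Lemma mulmx_colP (R : pzRingType) (p q : nat) (X Y : 'M[R]_(p, q)) :
  (forall x : 'cV[R]_q, X *m x = Y *m x) -> X = Y.
Proof.
move=> XY; apply/matrixP => i j.
by have := XY (delta_mx j 0); rewrite -!colE => /matrixP/(_ i 0); rewrite !mxE.
Qed.

Lemma mexp0 (R : realType) (d : nat) : mexp (0 : 'M[R]_d) = 1%:M.
Proof.
apply: mulmx_colP => x; rewrite mul1mx.
have h : acts_below (0 : 'M[R]_d) 0 by move=> y; rewrite mul0mx mul0r normr0.
have := mexp_taylor 1 x (lexx 0) h.
rewrite big_nat1 expr0 expr1 !mul0r fact0 invr1 scale1r normr_le0 subr_eq0.
by rewrite mul1mx => /eqP.
Qed.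

Lemma mulmx_mexpC (R : realType) (d : nat) (X : 'M[R]_d) :
  X *m mexp X = mexp X *m X.
Proof.
set u := series (fun k : nat => (k`!%:R)^-1 *: X ^+ k).
have cl : (fun n => u n *m X) @ \oo --> mexp X *m X.
  by apply: cvg_mulmx; [exact: cvg_mexp|exact: cvg_cst].
have cr : (fun n => X *m u n) @ \oo --> X *m mexp X.
  by apply: cvg_mulmx; [exact: cvg_cst|exact: cvg_mexp].
have E : (fun n => X *m u n) = (fun n => u n *m X).
  apply/funext => n; rewrite /u /series /= mulmx_suml mulmx_sumr.
  by apply: eq_bigr => k _; rewrite -scalemxAl -scalemxAr mulmxE -exprS -exprSr.
by rewrite E in cr; exact: (cvg_unique (@norm_hausdorff _ _) cr cl).
Qed.

Lemma mulmx_mexpZC (R : realType) (d : nat) (X : 'M[R]_d) (t : R) :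
  X *m mexp (t *: X) = mexp (t *: X) *m X.
Proof.
have [->|t0] := eqVneq t 0; first by rewrite scale0r mexp0 mulmx1 mul1mx.
apply: (@scalerI _ _ t t0); rewrite scalemxAl scalemxAr.
exact: mulmx_mexpC.
Qed.

(** Phrased in coordinates, where the mean value theorem applies. *)
Definition velocity (R : realType) (d : nat) (y : R -> 'cV[R]_d) (t : R)
    (dy : 'cV[R]_d) : Prop :=
  forall i, is_derive t 1 (fun s => y s i 0) (dy i 0).

Lemma is_derive_mexp (R : realType) (d : nat) (X : 'M[R]_d) (t : R) i j :
  is_derive t 1 (fun s => mexp (s *: X) i j) ((X *m mexp (t *: X)) i j).
Proof.
pose c (Y : 'M[R]_d) (k : nat) := (Y *m X ^+ k) i j / k`!%:R.
have cE (Y : 'M[R]_d) s :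
    pseries (c Y) s @ \oo --> (Y *m mexp (s *: X)) i j.
  have : (fun n => (Y *m series (fun k : nat => (k`!%:R)^-1 *: (s *: X) ^+ k) n) i j)
      @ \oo --> (Y *m mexp (s *: X)) i j.
    by apply: cvg_mxE; apply: cvg_mulmx; [exact: cvg_cst|exact: cvg_mexp].
  apply: cvg_trans; apply: near_eq_cvg; near=> n.
  rewrite /series /= mulmx_sumr summxE; apply: eq_bigr => k _.
  rewrite /c scalemx_expr scalerA -scalemxAr [LHS]mxE /=; ring.
have cdiff Y : pseries_diffs (c Y) = c (Y *m X).
  apply/funext => k; rewrite /pseries_diffs /c exprS -mulmxE mulmxA.
  by rewrite factS natrM invfM mulrCA mulVKf// pnatr_eq0.
have cv Y s : cvgn (pseries (c Y) s) by apply/cvg_ex; eexists; exact: cE.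
have -> : (fun s => mexp (s *: X) i j) = (fun s => limn (pseries (c 1%:M) s)).
  by apply/funext => s; rewrite (cvg_lim _ (cE 1%:M s))// mul1mx.
have <- : limn (pseries (pseries_diffs (c 1%:M)) t) = (X *m mexp (t *: X)) i j.
  by rewrite cdiff mul1mx (cvg_lim _ (cE X t)).
apply: (@pseries_snd_diffs _ _ (`|t| + 1)); rewrite ?cdiff//.
by rewrite (ger0_norm (addr_ge0 _ _))// ltrDl.
Unshelve. all: by end_near. Qed.

Lemma velocity_mexp (R : realType) (d : nat) (X : 'M[R]_d) (x : 'cV[R]_d) t :
  velocity (fun s => mexp (s *: X) *m x) t (X *m (mexp (t *: X) *m x)).
Proof.
move=> i.
have -> : (fun s => (mexp (s *: X) *m x) i 0) =
    \sum_(k < d) (x k 0 \*: (fun s => mexp (s *: X) i k)).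
  by apply/funext => s; rewrite mxE fct_sumE; apply: eq_bigr => k _; exact: mulrC.
have -> : (X *m (mexp (t *: X) *m x)) i 0 =
    \sum_(k < d) x k 0 *: (X *m mexp (t *: X)) i k.
  by rewrite mulmxA mxE; apply: eq_bigr => k _; exact: mulrC.
by apply: is_derive_sum => k; apply: is_deriveZ; exact: is_derive_mexp.
Qed.

(** Coordinates turn the mean value theorem into a uniqueness theorem: along a
    solution [y] the curve [mexp ((b - t) X) y(t)] has zero velocity. *)
Lemma linear_ode_unique (R : realType) (d : nat) (X : 'M[R]_d)
    (y : R -> 'cV[R]_d) (a b : R) :
  a <= b ->
  (forall i, {within `[a, b], continuous (fun t => y t i 0)}) ->
  (forall t, a < t < b -> velocity y t (X *m y t)) ->
  y b = mexp ((b - a) *: X) *m y a.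
Proof.
move=> ab yc dy.
pose u i t := (mexp ((b - t) *: X) *m y t) i 0.
have uE i : u i = \sum_(k < d) ((fun t => mexp ((b - t) *: X) i k) *
    (fun t => y t k 0)).
  by apply/funext => t; rewrite /u mxE fct_sumE.
have dm i k (t : R) : is_derive t 1 (fun s => mexp ((b - s) *: X) i k)
    (- (X *m mexp ((b - t) *: X)) i k).
  have db : is_derive t 1 (fun s : R => b - s) (-1).
    by have := is_deriveB (is_derive_cst b t 1) (is_derive_id t 1); rewrite sub0r.
  have := @is_derive1_comp _ (fun s => mexp (s *: X) i k) (fun s => b - s) t _ _
    (is_derive_mexp X (b - t) i k) db.
  by rewrite mulrN1.
have du i (t : R) : a < t < b -> is_derive t 1 (u i) 0.
  move=> /dy dyt; rewrite uE.
  have -> : 0 = \sum_(k < d) (mexp ((b - t) *: X) i k *: (X *m y t) k 0 +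
      y t k 0 *: (- (X *m mexp ((b - t) *: X)) i k)).
    rewrite big_split /=.
    have -> : \sum_(k < d) mexp ((b - t) *: X) i k *: (X *m y t) k 0 =
        (mexp ((b - t) *: X) *m (X *m y t)) i 0 by rewrite [RHS]mxE.
    have -> : \sum_(k < d) y t k 0 *: (- (X *m mexp ((b - t) *: X)) i k) =
        - ((X *m mexp ((b - t) *: X)) *m y t) i 0.
      rewrite [in RHS]mxE -sumrN; apply: eq_bigr => k _.
      by rewrite /GRing.scale/= mulrN mulrC.
    by rewrite mulmxA mulmx_mexpZC subrr.
  apply: is_derive_sum => k; have dk := dm i k t; have yk := dyt k.
  exact: is_deriveM.
have uc i : {within `[a, b], continuous (u i)}.
  move=> t; rewrite uE.
  have -> : \sum_(k < d) ((fun t => mexp ((b - t) *: X) i k) *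
      (fun t => y t k 0)) = fun t => \sum_(k < d) mexp ((b - t) *: X) i k * y t k 0.
    by apply/funext => s; rewrite fct_sumE.
  apply: cvg_big => [|k _]; first exact: add_continuous.
  apply: cvgM; last exact: yc.
  apply: continuous_subspaceT => s; apply: differentiable_continuous.
  by apply/derivable1_diffP; have [] := dm i k s.
apply/matrixP => i j; rewrite ord1.
have [t _] := MVT_segment ab (fun t tab => du i t tab) (uc i).
rewrite mul0r /u subrr scale0r mexp0 mul1mx => /eqP; rewrite subr_eq0.
by move=> /eqP.
Qed.

Lemma velocity_continuous (R : realType) (d : nat) (y : R -> 'cV[R]_d) (t : R)
    (dy : 'cV[R]_d) i :
  velocity y t dy -> {for t, continuous (fun s => y s i 0)}.
Proof.
move=> /(_ i) [dyi _]; apply: differentiable_continuous.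
exact/derivable1_diffP.
Qed.

Lemma mexpD_ge0 (R : realType) (d : nat) (X : 'M[R]_d) (s t : R) :
  0 <= s -> mexp ((s + t) *: X) = mexp (s *: X) *m mexp (t *: X).
Proof.
move=> s0; apply: mulmx_colP => x; rewrite -mulmxA.
have := @linear_ode_unique _ _ X (fun r => mexp (r *: X) *m x) t (s + t).
rewrite addrK => ->//.
- by rewrite lerDr.
- move=> i; apply: continuous_subspaceT => r.
  exact: velocity_continuous (velocity_mexp X x r).
- by move=> r _; exact: velocity_mexp.
Qed.

Lemma mexpD (R : realType) (d : nat) (X : 'M[R]_d) (s t : R) :
  mexp ((s + t) *: X) = mexp (s *: X) *m mexp (t *: X).
Proof.
have [s0|s0] := leP 0 s; first exact: mexpD_ge0.
rewrite -(opprK (s + t)) opprD scaleNr -scalerN mexpD_ge0 ?oppr_ge0 ?ltW//.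
by rewrite !scaleNr -!scalerN !opprK.
Qed.

Lemma mexpVK (R : realType) (d : nat) (X : 'M[R]_d) (t : R) :
  mexp (t *: X) *m mexp (- t *: X) = 1%:M.
Proof. by rewrite -mexpD subrr scale0r mexp0. Qed.

Lemma mexpKV (R : realType) (d : nat) (X : 'M[R]_d) (t : R) :
  mexp (- t *: X) *m mexp (t *: X) = 1%:M.
Proof. by rewrite -mexpD addNr scale0r mexp0. Qed.

Lemma velocity_mexp_damped (R : realType) (d : nat) (X : 'M[R]_d) (sg : R)
    (x : 'cV[R]_d) (t : R) :
  velocity (fun s => expR (- sg * s) *: (mexp (s *: X) *m x)) t
    ((X - sg%:M) *m (expR (- sg * t) *: (mexp (t *: X) *m x))).
Proof.
move=> i.
have dm : is_derive t 1 (fun s => (mexp (s *: X) *m x) i 0)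
    ((X *m (mexp (t *: X) *m x)) i 0) := velocity_mexp X x t i.
have de : is_derive t 1 (fun s : R => expR (- sg * s)) (expR (- sg * t) * - sg).
  have dz : is_derive t 1 (fun s : R => - sg * s) (- sg).
    have := is_deriveZ (- sg) (is_derive_id t 1).
    by rewrite [_ *: _]mulr1.
  exact: (@is_derive1_comp _ expR (fun s => - sg * s) t _ _ (is_derive_expR _) dz).
have -> : (fun s => (expR (- sg * s) *: (mexp (s *: X) *m x)) i 0) =
    (fun s => expR (- sg * s)) * (fun s => (mexp (s *: X) *m x) i 0).
  by apply/funext => s; rewrite mxE.
apply: (is_derive_eq (is_deriveM de dm)).
rewrite -scalemxAr mulmxBl mul_scalar_mx [RHS]mxE.
set u := mexp _ *m x; rewrite [X in _ = _ * X]mxE [X in _ = _ * (_ + X)]mxE.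
rewrite [X in _ = _ * (_ - X)]mxE /GRing.scale/=; ring.
Qed.

Lemma mexp_shift (R : realType) (d : nat) (X : 'M[R]_d) (sg t : R) :
  0 <= t -> mexp (t *: (X - sg%:M)) = expR (- sg * t) *: mexp (t *: X).
Proof.
move=> t0; apply: mulmx_colP => x.
have := @linear_ode_unique _ _ (X - sg%:M)
  (fun s => expR (- sg * s) *: (mexp (s *: X) *m x)) 0 t t0.
rewrite mulr0 expR0 scale0r mexp0 mul1mx scale1r subr0 -scalemxAl => ->//.
- move=> i; apply: continuous_subspaceT => r.
  exact: velocity_continuous (velocity_mexp_damped X sg x r).
- by move=> r _; exact: velocity_mexp_damped.
Qed.

Lemma velocityP (R : realType) (d : nat) (y : R -> 'cV[R]_d) (t : R)
    (dy : 'cV[R]_d) : velocity y t dy <-> is_derive t 1 y dy.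
Proof.
split=> [ydy|[dy1 dyE] i].
  have dv : derivable y t 1.
    by apply/derivable_mxP => i j; rewrite ord1; have [] := ydy i.
  apply: DeriveDef => //; rewrite derive_mx//.
  by apply/matrixP => i j; rewrite mxE ord1; have [_ <-] := ydy i.
apply: DeriveDef; first by move/derivable_mxP : dy1; exact.
by rewrite -dyE derive_mx// mxE.
Qed.

Lemma continuous_mexp (R : realType) (d : nat) (X : 'M[R]_d) :
  continuous (fun t : R => mexp (t *: X)).
Proof.
move=> t; apply: cvg_mx_entries => i j.
have [dX _] := is_derive_mexp X t i j.
by apply: differentiable_continuous; exact/derivable1_diffP.
Qed.

Lemma family_bound (R : realType) (d n : nat) (A : 'I_n -> 'M[R]_d) :
  exists2 M : R, 0 <= M & forall j, acts_below (A j) M.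
Proof.
exists (\sum_j d%:R * `|A j|); first by apply: sumr_ge0 => j _; rewrite mulr_ge0.
move=> j x; rewrite (le_trans (acts_below_norm _ _))// ler_wpM2r//.
by rewrite (bigD1 j)//= lerDl sumr_ge0// => i _; rewrite mulr_ge0.
Qed.

Lemma mexp_scale_below (R : realType) (d : nat) (X : 'M[R]_d) (M t : R) :
  0 <= M -> acts_below X M -> acts_below (mexp (t *: X)) (expR (M * `|t|)).
Proof.
move=> M0 XM; apply: mexp_acts_below => [|x]; first by rewrite mulr_ge0.
by rewrite -scalemxAl normrZ (mulrC M) -mulrA ler_wpM2l.
Qed.

Lemma mexp_scale_above (R : realType) (d : nat) (X : 'M[R]_d) (M t : R)
    (x : 'cV[R]_d) :
  0 <= M -> acts_below X M -> `|x| <= expR (M * `|t|) * `|mexp (t *: X) *m x|.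
Proof.
move=> M0 XM; have := mexp_scale_below (- t) M0 XM (mexp (t *: X) *m x).
by rewrite mulmxA mexpKV mul1mx normrN.
Qed.

(** * Seminorms and limits along ultrafilters *)

Definition is_seminorm (R : realType) (d : nat) (N : 'cV[R]_d -> R) : Prop :=
  (forall x y, N (x + y) <= N x + N y) /\
  (forall (a : R) x, N (a *: x) = `|a| * N x).

Lemma norm_seminorm (R : realType) (d : nat) (N : 'cV[R]_d -> R) :
  is_norm N -> is_seminorm N.
Proof. by case. Qed.

Lemma seminorm0 (R : realType) (d : nat) (N : 'cV[R]_d -> R) :
  is_seminorm N -> N 0 = 0.
Proof. by move=> [_ NZ]; rewrite -(scale0r 0) NZ normr0 mul0r. Qed.

Lemma seminormN (R : realType) (d : nat) (N : 'cV[R]_d -> R) x :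
  is_seminorm N -> N (- x) = N x.
Proof. by move=> [_ NZ]; rewrite -scaleN1r NZ normrN1 mul1r. Qed.

Lemma seminorm_ge0 (R : realType) (d : nat) (N : 'cV[R]_d -> R) x :
  is_seminorm N -> 0 <= N x.
Proof.
move=> NN; have [ND _] := NN; have := ND x (- x).
by rewrite subrr seminorm0// seminormN// -mulr2n pmulrn_lge0.
Qed.

Lemma seminorm_sub (R : realType) (d : nat) (N : 'cV[R]_d -> R) x y :
  is_seminorm N -> N x <= N y + N (x - y).
Proof. by move=> [ND _]; rewrite -{1}(subrKC y x); exact: ND. Qed.

Lemma seminorm_sum (R : realType) (d k : nat) (N : 'cV[R]_d -> R)
    (f : 'I_k -> 'cV[R]_d) :
  is_seminorm N -> N (\sum_i f i) <= \sum_i N (f i).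
Proof.
move=> NN; elim/big_ind2 : _ => [|x a y b xa yb|//]; first by rewrite seminorm0.
by rewrite (le_trans (NN.1 _ _))// lerD.
Qed.

Lemma seminorm_le_basis (R : realType) (d : nat) (N : 'cV[R]_d -> R) x :
  is_seminorm N -> N x <= (\sum_i N (delta_mx i 0)) * `|x|.
Proof.
move=> NN; rewrite {1}(matrix_sum_delta x) exchange_big big_ord1.
rewrite (le_trans (seminorm_sum _ NN))// mulr_suml ler_sum// => i _.
rewrite NN.2 mulrC ler_wpM2l ?normmx_ge_entry//.
exact: seminorm_ge0.
Qed.

Lemma ultra_fmap (T V : Type) (U : set_system T) (f : T -> V) :
  UltraFilter U -> UltraFilter (f @ U).
Proof.
move=> UU; split=> [|G GF UG]; first exact: fmap_proper_filter.
rewrite eqEsubset; split => // A GA.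
have [//|UnA] := in_ultra_setVsetC (f @^-1` A) UU.
have : G (A `&` ~` A) by apply: filterI => //; exact: UG.
by rewrite setICr => /filter_not_empty.
Qed.

Lemma ultra_bounded_cvg (R : realType) (T : Type) (U : set_system T)
    (f : T -> R) (C : R) :
  UltraFilter U -> (forall t, `|f t| <= C) -> exists a : R, f @ U --> a.
Proof.
move=> UU fC; have := @segment_compact R (- C) C.
rewrite compact_ultra => /(_ (f @ U) (ultra_fmap f UU)) [|a [_ fa]]; last by exists a.
apply: (@filterS _ U _ setT) => [t _|]; last exact: filterT.
by rewrite /= in_itv /= -ler_norml.
Qed.

(** Uniformly bounded seminorms are equi-Lipschitz, so a limit of unit vectors
    on which they tend to zero is a nonzero vector on which they tend to zero. *)
Lemma ultra_null_vector (R : realType) (d : nat) (T : Type) (U : set_system T)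
    (nu : T -> 'cV[R]_d -> R) (C : R) (x : T -> 'cV[R]_d) :
  UltraFilter U -> (forall t, is_seminorm (nu t)) ->
  (forall t y, nu t y <= C * `|y|) -> (forall t, `|x t| = 1) ->
  (fun t => nu t (x t)) @ U --> 0 ->
  exists2 z, z != 0 & (fun t => nu t z) @ U --> 0.
Proof.
move=> UU nuN nuC x1 nux.
have /choice[z zP] : forall i, exists a : R, (fun t => x t i 0) @ U --> a.
  move=> i; apply: (ultra_bounded_cvg (C := 1)) => t.
  by rewrite -(x1 t) normmx_ge_entry.
pose w := \col_i z i; have xw : x @ U --> w.
  by apply: cvg_mx_entries => i j; rewrite ord1 mxE; exact: zP.
exists w.
  rewrite -normr_eq0.
  have h : (fun t => `|x t|) @ U --> `|w| by exact: cvg_norm.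
  have h1 : (fun t => `|x t|) @ U --> (1 : R).
    by under eq_fun do rewrite x1; exact: cvg_cst.
  by rewrite (cvg_unique (@norm_hausdorff _ _) h h1)// oner_neq0.
apply: (@squeeze_cvgr _ _ _ _ (fun=> 0) (fun t => nu t (x t) + C * `|w - x t|)).
- near=> t; rewrite seminorm_ge0//= (le_trans (seminorm_sub _ (x t) (nuN t)))//.
  by rewrite lerD2l nuC.
- exact: cvg_cst.
- have h : (fun t => `|w - x t|) @ U --> `|w - w|.
    by apply: cvg_norm; apply: cvgB => //; exact: cvg_cst.
  rewrite subrr normr0 in h; rewrite -(addr0 0); apply: cvgD => //.
  by rewrite -(mulr0 C); exact: cvgMl_tmp.
Unshelve. all: by end_near. Qed.

(** Otherwise a limit of unit vectors would be a null vector of the norm. *)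
Lemma norm_dominates (R : realType) (d : nat) (N : 'cV[R]_d -> R) :
  is_norm N -> exists2 D : R, 0 < D & forall x, `|x| <= D * N x.
Proof.
move=> NN; have NS := norm_seminorm NN; apply: contrapT => noD.
have /choice[x xP] : forall k : nat, exists x, k.+1%:R * N x < `|x|.
  move=> k; apply: contrapT => nox; apply: noD; exists k.+1%:R => // x.
  by rewrite leNgt; apply/negP => ?; apply: nox; exists x.
have xgt0 k : 0 < `|x k|.
  by rewrite (le_lt_trans _ (xP k))// mulr_ge0// seminorm_ge0.
have [U [UU oU]] := ultraFilterLemma (F := \oo) _.
pose y k := `|x k|^-1 *: x k.
have y1 k : `|y k| = 1 by rewrite normrZ normfV normr_id mulVf// gt_eqF.
have Ny : (fun k => N (y k)) @ U --> 0.
  apply: cvg_trans (cvg_app _ oU) _.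
  apply: (@squeeze_cvgr _ _ _ _ (fun=> 0) (@harmonic R)).
  - near=> k; rewrite seminorm_ge0//= NS.2 normfV normr_id /harmonic/=.
    by rewrite mulrC ler_pdivrMr// ler_pdivlMl// ltW.
  - exact: cvg_cst.
  - exact: cvg_harmonic.
have [z z0 Nz] := ultra_null_vector UU (fun=> NS)
  (fun=> (fun y => seminorm_le_basis y NS)) y1 Ny.
move: z0; rewrite (_ : z = 0) ?eqxx//; case: NN => _ _; apply.
have h : (fun _ : nat => N z) @ U --> N z by exact: cvg_cst.
exact: (cvg_unique (@norm_hausdorff _ _) h Nz).
Unshelve. all: by end_near. Qed.

Lemma seminorm_continuous (R : realType) (d : nat) (N : 'cV[R]_d -> R) :
  is_seminorm N -> continuous N.
Proof.
move=> NN x; set D := \sum_i N (delta_mx i 0).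
have D1 : 0 < D + 1 by rewrite ltr_wpDl// sumr_ge0// => i _; exact: seminorm_ge0.
have FF : Filter (nbhs x) by exact: nbhs_filter.
apply: (proj2 (@cvgrPdist_le _ _ _ (nbhs x) FF N (N x))) => e e0.
have /(@cvgrPdist_le _ _ _ (nbhs x) FF) xe :
    (id : 'cV[R]_d -> 'cV[R]_d) @ x --> x by exact: cvg_id.
near=> y; have xy : D * `|x - y| <= e.
  rewrite (le_trans (ler_wpM2r (normr_ge0 _) (_ : D <= D + 1)))// ?lerDl//.
  rewrite -ler_pdivlMl//; near: y; apply: xe.
  by rewrite mulr_gt0// invr_gt0.
rewrite ler_distlC; apply/andP; split.
  rewrite lerBlDr (le_trans (seminorm_sub x y NN))// lerD2l.
  exact: le_trans (seminorm_le_basis _ NN) xy.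
rewrite (le_trans (seminorm_sub y x NN))// lerD2l -opprB seminormN//.
exact: le_trans (seminorm_le_basis _ NN) xy.
Unshelve. all: by end_near. Qed.

(** * The joint spectral radius as a growth rate *)

(** [C] is uniform over the trajectories; the infimum of these [s] is the
    logarithm of the joint spectral radius. *)
Definition path_growth (R : realType) (d n : nat) (A : 'I_n -> 'M[R]_d)
    (m h s : R) : Prop :=
  exists C : R, forall v x, discrete_trajectory A m h v x ->
    forall k, `|x k| <= C * expR (s * path_time m h v k) * `|x 0|.

Lemma edge_opE (R : realType) (d n : nat) (A : 'I_n -> 'M[R]_d) (m h : R) j i :
  edge_op A m h j i = mexp (edge_time m h j i *: A j).
Proof. by rewrite /edge_op /edge_time; case: ifP. Qed.

Lemma edge_time_gt0 (R : realType) (n : nat) (m h : R) (j i : 'I_n) :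
  0 < m -> 0 < h -> 0 < edge_time m h j i.
Proof. by rewrite /edge_time; case: ifP. Qed.

Lemma path_timeS (R : realType) (n : nat) (m h : R) (v : nat -> 'I_n) k :
  path_time m h v k.+1 = path_time m h v k + edge_time m h (v k.+1) (v k).
Proof. by rewrite /path_time big_ord_recr. Qed.

Lemma path_timeD (R : realType) (n : nat) (m h : R) (v : nat -> 'I_n) k l :
  path_time m h v (k + l) =
  path_time m h v k + path_time m h (fun s => v (k + s)%N) l.
Proof.
rewrite /path_time big_split_ord /=; congr (_ + _).
by apply: eq_bigr => s _; rewrite addnS.
Qed.

Lemma path_time_ge (R : realType) (n : nat) (m h : R) (v : nat -> 'I_n) k :
  Num.min m h * k%:R <= path_time m h v k.
Proof.
elim: k => [|k IHk]; first by rewrite mulr0 /path_time big_ord0.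
rewrite path_timeS -natr1 mulrDr mulr1 lerD// /edge_time.
by case: ifP; rewrite ge_min lexx ?orbT.
Qed.

Lemma path_time_le (R : realType) (n : nat) (m h : R) (v : nat -> 'I_n) k :
  path_time m h v k <= Num.max m h * k%:R.
Proof.
elim: k => [|k IHk]; first by rewrite mulr0 /path_time big_ord0.
rewrite path_timeS -natr1 mulrDr mulr1 lerD// /edge_time.
by case: ifP; rewrite le_max lexx ?orbT.
Qed.

Lemma path_time_gt0 (R : realType) (n : nat) (m h : R) (v : nat -> 'I_n) k :
  0 < m -> 0 < h -> (0 < k)%N -> 0 < path_time m h v k.
Proof.
move=> m0 h0 k0; apply: lt_le_trans (path_time_ge _ _ _ _).
by rewrite mulr_gt0 ?ltr0n// lt_min m0.
Qed.

Lemma discrete_trajectory_exists (R : realType) (d n : nat)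
    (A : 'I_n -> 'M[R]_d) (m h : R) (v : nat -> 'I_n) (x0 : 'cV[R]_d) :
  exists2 x, discrete_trajectory A m h v x & x 0%N = x0.
Proof.
exists (fix x k := if k is k'.+1 then edge_op A m h (v k'.+1) (v k') *m x k'
                   else x0) => //.
Qed.

Lemma discrete_trajectory_shift (R : realType) (d n : nat)
    (A : 'I_n -> 'M[R]_d) (m h : R) v x k :
  discrete_trajectory A m h v x ->
  discrete_trajectory A m h (fun s => v (k + s)%N) (fun s => x (k + s)%N).
Proof. by move=> vx s; rewrite addnS; exact: vx. Qed.

Lemma discrete_trajectoryZ (R : realType) (d n : nat)
    (A : 'I_n -> 'M[R]_d) (m h : R) v x (a : R) :
  discrete_trajectory A m h v x ->
  discrete_trajectory A m h v (fun s => a *: x s).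
Proof. by move=> vx s; rewrite vx scalemxAr. Qed.

Section discrete_growth.
Context (R : realType) (d n : nat) (A : 'I_n -> 'M[R]_d) (m h M : R)
  (m_gt0 : 0 < m) (h_gt0 : 0 < h) (M_ge0 : 0 <= M)
  (A_bound : forall j, acts_below (A j) M).

Lemma discrete_upper v x k : discrete_trajectory A m h v x ->
  `|x k| <= expR (M * path_time m h v k) * `|x 0%N|.
Proof.
move=> vx; elim: k => [|k IHk].
  by rewrite /path_time big_ord0 mulr0 expR0 mul1r.
rewrite vx edge_opE (le_trans (mexp_scale_below _ M_ge0 (A_bound _) _))//.
rewrite path_timeS mulrDr expRD gtr0_norm ?edge_time_gt0//.
by rewrite [_ * expR _]mulrC -mulrA ler_wpM2l// expR_ge0.
Qed.

Lemma discrete_lower v x k : discrete_trajectory A m h v x ->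
  `|x 0%N| <= expR (M * path_time m h v k) * `|x k|.
Proof.
move=> vx; elim: k => [|k IHk].
  by rewrite /path_time big_ord0 mulr0 expR0 mul1r.
rewrite (le_trans IHk)// path_timeS mulrDr expRD -mulrA ler_wpM2l ?expR_ge0//.
have := mexp_scale_above (edge_time m h (v k.+1) (v k)) (x k) M_ge0
  (A_bound (v k.+1)).
by rewrite vx edge_opE gtr0_norm ?edge_time_gt0.
Qed.

Lemma discrete_trajectory_neq0 v x k : discrete_trajectory A m h v x ->
  0 < `|x 0%N| -> 0 < `|x k|.
Proof.
move=> vx x0; have := lt_le_trans x0 (discrete_lower k vx).
by rewrite pmulr_rgt0// expR_gt0.
Qed.

Lemma path_growth_upper : path_growth A m h M.
Proof. by exists 1 => v x vx k; rewrite mul1r; exact: discrete_upper. Qed.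

Lemma path_growth_lower (d_gt0 : (0 < d)%N) (n_gt0 : (0 < n)%N) s :
  path_growth A m h s -> - M <= s.
Proof.
move=> [C sC]; rewrite leNgt; apply/negP => sM.
pose v := fun _ : nat => Ordinal n_gt0.
have [e e1] := unit_vector_exists R d_gt0.
have [x vx x0] := discrete_trajectory_exists A m h v e.
have nx0 : 0 < `|x 0%N| by rewrite x0 e1.
(* Trajectories decay at most at the rate [M], and path times are unbounded. *)
have key k : (- M - s) * path_time m h v k <= C.
  rewrite (le_trans (_ : _ <= 1 + (- M - s) * path_time m h v k)) ?lerDr//.
  rewrite (le_trans (expR_ge1Dx _))//.
  have := le_trans (discrete_lower k vx) (ler_wpM2l (expR_ge0 _) (sC v x vx k)).
  rewrite !mulrA -{1}[`|x 0%N|]mul1r ler_pM2r// => h1.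
  rewrite (_ : (- M - s) * _ = - (M * path_time m h v k + s * path_time m h v k)).
    rewrite expRN -div1r ler_pdivrMr ?expR_gt0// expRD (le_trans h1)//.
    by rewrite [leLHS]mulrAC mulrC.
  ring.
have sM0 : 0 < - M - s by rewrite subr_gt0.
have mh0 : 0 < Num.min m h by rewrite lt_min m_gt0.
have [k kC] : exists k : nat, C < (- M - s) * (Num.min m h * k%:R).
  exists (Num.truncn (C / ((- M - s) * Num.min m h))).+1.
  rewrite mulrA mulrC -ltr_pdivrMr ?mulr_gt0//.
  exact: truncnS_gt.
have := lt_le_trans kC (le_trans (ler_wpM2l (ltW sM0) (path_time_ge m h v k)) (key k)).
by rewrite ltxx.
Qed.

Lemma root_le_expR (a t s : R) : 0 < a -> 0 < t ->
  (a `^ t^-1 <= expR s) = (a <= expR (s * t)).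
Proof.
move=> a0 t0; rewrite /powR gt_eqF// ler_expR mulrC ler_pdivrMr//.
by rewrite -{2}(lnK a0) ler_expR.
Qed.


(** Blocks of [k] edges concatenate, and the fewer than [k] edges that are left
    over cost a constant. *)
Lemma path_growth_of_block k s : (0 < k)%N -> s <= M ->
  (forall v x, discrete_trajectory A m h v x ->
     `|x k| <= expR (s * path_time m h v k) * `|x 0%N|) ->
  path_growth A m h s.
Proof.
move=> k0 sM kb; exists (expR ((M - s) * (Num.max m h * k%:R))) => v x vx.
have qk q v' x' : discrete_trajectory A m h v' x' ->
    `|x' (q * k)%N| <= expR (s * path_time m h v' (q * k)) * `|x' 0%N|.
  elim: q v' x' => [|q IHq] v' x' v'x'.
    by rewrite mul0n /path_time big_ord0 mulr0 expR0 mul1r.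
  rewrite mulSn path_timeD mulrDr expRD.
  have := IHq _ _ (discrete_trajectory_shift k v'x'); rewrite addn0.
  move=> /le_trans; apply; rewrite [X in _ <= X * _]mulrC -mulrA.
  by rewrite ler_wpM2l ?expR_ge0// kb.
move=> j; rewrite (divn_eq j k) path_timeD mulrDr expRD.
set q := (j %/ k)%N; set r := (j %% k)%N.
have vx' := discrete_trajectory_shift (q * k) vx.
have := discrete_upper r vx'; rewrite addn0.
move=> /le_trans; apply.
rewrite (le_trans (ler_wpM2l (expR_ge0 _) (qk q _ _ vx)))//.
set T := path_time m h _ r; set e := expR (s * path_time m h v (q * k)).
have : expR (M * T) <= expR ((M - s) * (Num.max m h * k%:R)) * expR (s * T).
  rewrite -expRD ler_expR -lerBlDr -mulrBl ler_wpM2l ?subr_ge0//.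
  rewrite (le_trans (path_time_le _ _ _ _))// ler_wpM2l ?ler_nat//.
    by rewrite le_max (ltW m_gt0).
  by rewrite ltnW// ltn_pmod.
move=> /(ler_wpM2r (mulr_ge0 (expR_ge0 (s * path_time m h v (q * k)))
  (normr_ge0 (x 0%N)))) /le_trans; apply.
by rewrite le_eqVlt; apply/orP; left; apply/eqP; rewrite /e; ring.
Qed.

Lemma jsr_set_ubound k : (0 < k)%N ->
  ubound [set r : R | exists (v : nat -> 'I_n) (x : nat -> 'cV[R]_d),
    [/\ discrete_trajectory A m h v x, `|x 0%N| = 1 &
        r = `|x k| `^ (path_time m h v k)^-1]] (expR M).
Proof.
move=> k0 _ [v [x [vx x0 ->]]].
rewrite root_le_expR ?path_time_gt0//; last first.
  by apply: discrete_trajectory_neq0 vx _; rewrite x0.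
by have := discrete_upper k vx; rewrite x0 mulr1.
Qed.

(** The least exponential growth rate [s0] is the limit of [jsr_seq] in
    logarithmic scale.  A value of [jsr_seq] below [expR s0] would bound all
    blocks of [k] edges, hence all trajectories, at a smaller rate; and a bound
    at any rate above [s0] absorbs its multiplicative constant in the long run. *)
Lemma jsr_growth (d_gt0 : (0 < d)%N) (n_gt0 : (0 < n)%N) :
  [/\ joint_spectral_radius A m h = expR (sigma_discr A m h),
      `|sigma_discr A m h| <= M &
      forall s, path_growth A m h s -> sigma_discr A m h <= s].
Proof.
pose G := [set s | path_growth A m h s].
have Gm : lbound G (- M) by move=> s; exact: path_growth_lower.
have GM : G M by exact: path_growth_upper.
have Ginf : has_inf G by split; [exists M|exists (- M)].
set s0 := inf G.
have s0M : s0 <= M by apply: ge_inf => //; exists (- M).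
have s0m : - M <= s0 by apply: lb_le_inf => //; exists M.
have jsrP k : (0 < k)%N -> forall v x, discrete_trajectory A m h v x ->
    `|x 0%N| = 1 ->
    `|x k| `^ (path_time m h v k)^-1 <= jsr_seq A m h (fun=> Num.norm) k.
  move=> k0 v x vx x0; apply: ub_le_sup; last by exists v, x.
  by exists (expR M); exact: jsr_set_ubound.
have [e1 e1E] := unit_vector_exists R d_gt0.
have [x1 vx1 x10] := discrete_trajectory_exists A m h (fun=> Ordinal n_gt0) e1.
have nx1 : `|x1 0%N| = 1 by rewrite x10.
have low k : (0 < k)%N -> expR s0 <= jsr_seq A m h (fun=> Num.norm) k.
  move=> k0; rewrite leNgt; apply/negP => jk.
  set J := jsr_seq _ _ _ _ _ in jk.
  have J0 : 0 < J.
    apply: lt_le_trans (jsrP k k0 _ _ vx1 nx1); rewrite powR_gt0//.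
    by apply: discrete_trajectory_neq0 vx1 _; rewrite nx1.
  suff Gs : path_growth A m h (ln J).
    have : s0 <= ln J by apply: ge_inf => //; exists (- M).
    by rewrite -ler_expR lnK// leNgt jk.
  apply: (path_growth_of_block k0).
    by rewrite (le_trans _ s0M)// -ler_expR lnK// ltW.
  move=> v x vx; have [x00|x00] := eqVneq `|x 0%N| 0.
    have := discrete_upper k vx; rewrite x00 !mulr0 => /le_trans; exact.
  have x0p : 0 < `|x 0%N| by rewrite lt_def x00/=.
  have vx' := discrete_trajectoryZ (`|x 0%N|^-1) vx.
  have nx' : `| `|x 0%N|^-1 *: x 0%N| = 1 by rewrite normrZ normfV normr_id mulVf.
  have := jsrP k k0 _ _ vx' nx'; rewrite -/J -{1}(lnK J0).
  rewrite root_le_expR ?path_time_gt0//; last first.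
    by apply: (discrete_trajectory_neq0 _ vx'); rewrite nx'.
  by rewrite normrZ normfV normr_id mulrC ler_pdivrMr.
have high s : s0 < s -> \forall k \near \oo,
    jsr_seq A m h (fun=> Num.norm) k <= expR s.
  move=> s0s; have [|s1 [C sC] s1s] := @inf_adherent _ G (s - s0) _ Ginf.
    by rewrite subr_gt0.
  rewrite subrKC in s1s.
  have mh0 : 0 < Num.min m h by rewrite lt_min m_gt0.
  near=> k.
  have k0 : (0 < k)%N by near: k; exact: nbhs_infty_gt.
  apply: ge_sup.
    exists (`|x1 k| `^ (path_time m h (fun=> Ordinal n_gt0) k)^-1).
    by exists (fun=> Ordinal n_gt0), x1.
  move=> _ [v [x [vx x0 ->]]].
  rewrite root_le_expR ?path_time_gt0//; last first.
    by apply: discrete_trajectory_neq0 vx _; rewrite x0.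
  rewrite (le_trans (sC v x vx k))// x0 mulr1.
  rewrite -ler_pdivlMr ?expR_gt0// -expRN -expRD -mulNr -mulrDl.
  rewrite (le_trans _ (expR_ge1Dx _))//.
  rewrite (le_trans _ (_ : (s - s1) * path_time m h v k <= _)) ?lerDr//.
  rewrite (le_trans _ (ler_wpM2l _ (path_time_ge _ _ _ _)))//; last first.
    by rewrite subr_ge0 ltW.
  rewrite mulrA mulrC -ler_pdivrMr ?mulr_gt0 ?subr_gt0//.
  by near: k; exact: nbhs_infty_ger.
have jlim : jsr_seq A m h (fun=> Num.norm) @ \oo --> expR s0.
  apply/cvgrPdist_le => e e0.
  have E0 : 0 < expR s0 + e by rewrite addr_gt0 ?expR_gt0.
  near=> k; have k0 : (0 < k)%N by near: k; exact: nbhs_infty_gt.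
  rewrite ler0_norm ?subr_le0 ?low// opprB lerBlDl -(lnK E0).
  near: k; apply: high.
  by rewrite -ltr_expR (lnK E0) ltrDl.
have jE : joint_spectral_radius A m h = expR s0 by exact: cvg_lim jlim.
have sE : sigma_discr A m h = s0 by rewrite /sigma_discr jE expRK.
rewrite sE jE; split=> //; first by rewrite ler_norml s0m.
by move=> s Gs; apply: ge_inf => //; exists (- M).
Unshelve. all: by end_near. Qed.

End discrete_growth.

(** * Trajectories made of stays, and the lower bound *)

Section stays.
Context (R : realType) (d n : nat) (A : 'I_n -> 'M[R]_d) (m : R).

(** A stay [p] is a stationary interval of length [p.2] at the matrix with index
    [p.1]; a word lists consecutive stays in the order of time. *)
Definition stay_op (p : 'I_n * R) : 'M[R]_d := mexp (p.2 *: A p.1).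

Fixpoint word_op (w : seq ('I_n * R)) : 'M[R]_d :=
  if w is p :: w' then word_op w' *m stay_op p else 1%:M.

Definition word_time (w : seq ('I_n * R)) : R := \sum_(p <- w) p.2.

Definition word_admissible (w : seq ('I_n * R)) : bool :=
  all (fun p => m <= p.2) w.

Lemma word_op_cat w1 w2 : word_op (w1 ++ w2) = word_op w2 *m word_op w1.
Proof. by elim: w1 => [|p w1 IH] /=; rewrite ?mulmx1// IH mulmxA. Qed.

Lemma word_op_rcons w p : word_op (rcons w p) = stay_op p *m word_op w.
Proof. by rewrite -cats1 word_op_cat /= mul1mx. Qed.

Lemma word_time_cat w1 w2 : word_time (w1 ++ w2) = word_time w1 + word_time w2.
Proof. exact: big_cat. Qed.

Lemma word_time_rcons w p : word_time (rcons w p) = word_time w + p.2.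
Proof. by rewrite -cats1 word_time_cat /word_time big_seq1. Qed.

Lemma word_op_inv w : exists V, word_op w *m V = 1%:M.
Proof.
elim: w => [|p w [V wV]] /=; first by exists 1%:M; rewrite mulmx1.
exists (mexp (- p.2 *: A p.1) *m V).
by rewrite -mulmxA [X in _ *m X]mulmxA mexpVK mul1mx.
Qed.

Variable (u : nat -> 'I_n * R).
Hypothesis u_ge : forall k, m <= (u k).2.
Hypothesis m_gt0 : 0 < m.

Let tau k := word_time (mkseq u k).

Lemma mkseqS k : mkseq u k.+1 = rcons (mkseq u k) (u k).
Proof. by rewrite /mkseq -addn1 iotaD map_cat cats1 add0n. Qed.

Let tau0 : tau 0 = 0. Proof. by rewrite /tau /word_time big_nil. Qed.

Let tauS k : tau k.+1 = tau k + (u k).2.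
Proof. by rewrite /tau mkseqS word_time_rcons. Qed.

Let tau_lt k : tau k < tau k.+1.
Proof. by rewrite tauS ltrDl (lt_le_trans m_gt0). Qed.

Let tau_le k l : (k <= l)%N -> tau k <= tau l.
Proof.
move=> kl; rewrite -(subnKC kl); elim: (l - k)%N => [|i IH].
  by rewrite addn0.
by rewrite (le_trans IH)// addnS ltW.
Qed.

Let tau_ge k : m * k%:R <= tau k.
Proof.
elim: k => [|k IH]; first by rewrite mulr0 tau0.
by rewrite tauS -natr1 mulrDr mulr1 lerD.
Qed.

(** The time spent in the [k]-th stay up to time [t]; it is continuous in [t],
    which makes the concatenated solution continuous without gluing. *)
Let elapsed k (t : R) : R := Num.min (Num.max (t - tau k) 0) (u k).2.

Let flow (x0 : 'cV[R]_d) := fix flow k t := if k is k'.+1 then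
  mexp (elapsed k' t *: A (u k').1) *m flow k' t else x0.

Let flow_continuous x0 k : continuous (flow x0 k).
Proof.
elim: k => [|k IH] t /=; first exact: cvg_cst.
apply: cvg_mulmx; last exact: IH.
apply: (cvg_comp (elapsed k) (fun s => mexp (s *: A (u k).1))); last first.
  exact: continuous_mexp.
apply: (@continuous_min _ _ (fun t => Num.max (t - tau k) 0) (fun=> (u k).2)).
  apply: (@continuous_max _ _ (fun t => t - tau k) (fun=> 0)).
    by apply: cvgB; [exact: cvg_id|exact: cvg_cst].
  exact: cvg_cst.
exact: cvg_cst.
Qed.

Let flow_stable x0 k l t : (k <= l)%N -> t <= tau k -> flow x0 l t = flow x0 k t.
Proof.
move=> kl tk; rewrite -(subnKC kl); elim: (l - k)%N => [|i IH].
  by rewrite addn0.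
have ti : t <= tau (k + i) by rewrite (le_trans tk)// tau_le// leq_addr.
rewrite addnS /= IH /elapsed (max_r (_ : t - _ <= 0)) ?subr_le0//.
rewrite (min_l (_ : 0 <= _)); last by rewrite (le_trans (ltW m_gt0)).
by rewrite scale0r mexp0 mul1mx.
Qed.

Let flow_word x0 k t : tau k <= t -> flow x0 k t = word_op (mkseq u k) *m x0.
Proof.
elim: k => [|k IH] tk; first by rewrite /= mul1mx.
have -> : flow x0 k.+1 t = mexp (elapsed k t *: A (u k).1) *m flow x0 k t by [].
have tk' : tau k <= t by rewrite (le_trans _ tk)// ltW.
rewrite IH// mkseqS word_op_rcons -mulmxA /elapsed /stay_op.
have st : (u k).2 <= t - tau k by rewrite lerBrDl -tauS.
rewrite (max_l (_ : 0 <= _)); last by rewrite subr_ge0.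
by rewrite min_r.
Qed.

Lemma word_trajectory (x0 : 'cV[R]_d) :
  exists2 x, trajectory A m x &
    forall k, x (word_time (mkseq u k)) = word_op (mkseq u k) *m x0.
Proof.
pose K (t : R) := (Num.truncn (t / m)).+1.
have tK t : t <= tau (K t).
  rewrite (le_trans _ (tau_ge _))// -ler_pdivrMl// mulrC.
  by rewrite ltW// truncnS_gt.
pose x t := flow x0 (K t) t.
have xE k t : t <= tau k -> x t = flow x0 k t.
  move=> tk; rewrite /x; have [kK|/ltnW Kk] := leqP k (K t).
    exact: flow_stable.
  by apply/esym/flow_stable.
pose kappa t := xget 0%N [set k | tau k <= t < tau k.+1].
have kappaE k t : tau k <= t < tau k.+1 -> kappa t = k.
  move=> kt; rewrite /kappa; case: xgetP => [l _ /andP[lt1 lt2]|]; last first.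
    by move=> /(_ k).
  case/andP: kt => kt1 kt2; apply/eqP; rewrite eqn_leq.
  apply/andP; split; rewrite leqNgt; apply/negP => /tau_le.
    by move=> /(lt_le_trans kt2) /lt_le_trans/(_ lt1); rewrite ltxx.
  by move=> /(lt_le_trans lt2) /lt_le_trans/(_ kt1); rewrite ltxx.
exists x => [|k]; last by rewrite (xE k)// flow_word.
have xnear k t : t < tau k -> \near t, flow x0 k t = x t.
  move=> tk; near=> s; rewrite (xE k)//; apply: ltW.
  by near: s; exact: lt_nbhsl.
exists tau, (fun t => A (u (kappa t)).1); split.
- split=> // k; first by rewrite tauS lerD2l.
  by exists (u k).1 => t kt; rewrite (kappaE k).
- apply: continuous_subspaceT => t.
  have tKt : t < tau (K t).+1 by rewrite (le_lt_trans (tK t)).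
  rewrite /continuous_at (xE (K t).+1 t (ltW tKt)).
  apply: (cvg_trans _ (@flow_continuous x0 (K t).+1 t)).
  by apply: near_eq_cvg; exact: xnear.
- move=> k t /andP[kt tk1].
  rewrite (kappaE k) ?(ltW kt)//.
  pose p := word_op (mkseq u k) *m x0.
  pose y s := mexp (s *: A (u k).1) *m p.
  have fE s : tau k <= s -> s <= tau k.+1 -> flow x0 k.+1 s = y (s - tau k).
    move=> ks sk /=; rewrite (flow_word x0 ks) /elapsed (max_l (_ : 0 <= _)).
      by rewrite min_l// lerBlDl -tauS.
    by rewrite subr_ge0.
  apply: (@near_eq_is_derive _ _ _ (fun s => y (s - tau k))).
    near=> s; rewrite (xE k.+1).
      rewrite fE//; apply: ltW; near: s; first exact: lt_nbhsr.
      exact: lt_nbhsl.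
    by apply: ltW; near: s; exact: lt_nbhsl.
  rewrite (xE k.+1) ?ltW// fE ?ltW//; apply/velocityP => i.
  have dy := velocity_mexp (A (u k).1) p (t - tau k) i.
  have ds : is_derive t 1 (fun s : R => s - tau k) 1.
    by have := is_deriveB (is_derive_id t 1) (is_derive_cst (tau k) t 1); rewrite subr0.
  have := @is_derive1_comp _ (fun s => y s i 0) (fun s => s - tau k) t _ _ dy ds.
  by rewrite mulr1.
Unshelve. all: by end_near. Qed.

End stays.

(** The exponents [al] whose infimum is [lyapunov_exponent]. *)
Definition trajectory_growth (R : realType) (d n : nat) (A : 'I_n -> 'M[R]_d)
    (m al : R) : Prop :=
  forall x : R -> 'cV[R]_d, trajectory A m x ->
    exists C : R, forall t : R, 0 <= t -> `|x t| <= C * expR (al * t).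

Lemma seminorm_mulmx (R : realType) (d : nat) (X : 'M[R]_d) :
  is_seminorm (fun x => `|X *m x|).
Proof.
split=> [x y|a x]; first by rewrite mulmxDr ler_normD.
by rewrite -scalemxAr normrZ.
Qed.

(** Nested words, the finite stages of the infinite word of a gliding hump. *)
Fixpoint prefixes (T : Type) (f : seq T -> nat -> seq T) (k : nat) : seq T :=
  if k is k'.+1 then prefixes f k' ++ f (prefixes f k') k' else [::].

Lemma prefixes_le (T : Type) (f : seq T -> nat -> seq T) k l : (k <= l)%N ->
  exists s, prefixes f l = prefixes f k ++ s.
Proof.
move=> kl; rewrite -(subnKC kl); elim: (l - k)%N => [|i [s IH]].
  by exists [::]; rewrite addn0 cats0.
by exists (s ++ f (prefixes f (k + i)) (k + i)%N); rewrite addnS /= IH catA.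
Qed.

Lemma prefixes_size (T : Type) (f : seq T -> nat -> seq T) k :
  (forall w k, (0 < size (f w k))%N) -> (k <= size (prefixes f k))%N.
Proof.
move=> f0; elim: k => // k IH; rewrite /= size_cat.
by rewrite -addn1 leq_add.
Qed.

Lemma prefixes_limit (T : Type) (x0 : T) (f : seq T -> nat -> seq T) :
  (forall w k, (0 < size (f w k))%N) ->
  let u k := nth x0 (prefixes f k.+1) k in
  forall k, prefixes f k = mkseq u (size (prefixes f k)).
Proof.
move=> f0 u k; apply: (@eq_from_nth _ x0); first by rewrite size_mkseq.
move=> i ik; rewrite nth_mkseq// /u.
have ii : (i < size (prefixes f i.+1))%N by exact: prefixes_size.
case/orP: (leq_total k i.+1) => /(prefixes_le f)[s E].
  by rewrite E nth_cat ik.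
by rewrite E nth_cat ii.
Qed.

(** A gliding hump.  Were the words not uniformly bounded, a word could be
    prolonged so as to beat any prescribed constant, because the operator of the
    word already written is invertible; an infinite prolongation would then
    follow a trajectory that beats the exponent, for some basis vector. *)
Lemma word_uniform_bound (R : realType) (d n : nat) (A : 'I_n -> 'M[R]_d)
    (m al : R) :
  (0 < n)%N -> 0 < m -> trajectory_growth A m al ->
  exists C, forall w, word_admissible m w ->
    acts_below (word_op A w) (C * expR (al * word_time w)).
Proof.
move=> n_gt0 m_gt0 alT; apply: contrapT => noC.
have grow C : exists2 w, word_admissible m w &
    exists y : 'cV[R]_d, C * expR (al * word_time w) * `|y| < `|word_op A w *m y|.
  apply: contrapT => now; apply: noC; exists C => w wm y.
  rewrite leNgt; apply/negP => wy; apply: now; exists w => //.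
  by exists y.
have step (W : seq ('I_n * R)) (k : nat) : exists w, [/\ word_admissible m w,
    (0 < size w)%N & exists y : 'cV[R]_d, k%:R * expR (al * word_time (W ++ w)) * `|y|
      < `|word_op A (W ++ w) *m y|].
  have [V WV] := word_op_inv A W.
  set B := d%:R * `|V|; have B0 : 0 <= B by rewrite mulr_ge0.
  pose C := 1 + k%:R * expR (al * word_time W) * B.
  have C1 : 1 <= C by rewrite lerDl !mulr_ge0// expR_ge0.
  have [w wm [y wy]] := grow C.
  exists w; split=> //.
    case: w wm wy => // _; rewrite /= mul1mx /word_time big_nil mulr0 expR0 mulr1.
    by rewrite ltNge -{1}[`|y|]mul1r ler_wpM2r.
  exists (V *m y); rewrite word_op_cat mulmxA -(mulmxA _ _ V) WV mulmx1.
  apply: le_lt_trans wy; rewrite word_time_cat mulrDr expRD.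
  rewrite (le_trans (ler_wpM2l _ (acts_below_norm V y)))//.
  rewrite -/B (_ : _ * (B * _) = (k%:R * expR (al * word_time W) * B) *
     expR (al * word_time w) * `|y|); last by ring.
  by rewrite ler_wpM2r// ler_wpM2r ?expR_ge0// /C lerDr.
have /choice[f fP] : forall Wk : seq ('I_n * R) * nat, exists w,
    [/\ word_admissible m w, (0 < size w)%N &
     exists y : 'cV[R]_d, Wk.2%:R * expR (al * word_time (Wk.1 ++ w)) * `|y|
      < `|word_op A (Wk.1 ++ w) *m y|] by move=> Wk; exact: step.
pose g W k := f (W, k).
have g0 W k : (0 < size (g W k))%N by have [] := fP (W, k).
have gm k : word_admissible m (prefixes g k).
  elim: k => // k IH; rewrite /= /word_admissible all_cat.
  by apply/andP; split; [exact: IH|have [] := fP (prefixes g k, k)].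
pose u k := nth (Ordinal n_gt0, m) (prefixes g k.+1) k.
have uE k : prefixes g k = mkseq u (size (prefixes g k)) by exact: prefixes_limit.
have um k : m <= (u k).2.
  have /all_nthP := gm k.+1; apply; exact: prefixes_size.
have /choice[c cP] : forall i : 'I_d, exists C, forall N,
    `|word_op A (mkseq u N) *m (delta_mx i 0 : 'cV[R]_d)|
      <= C * expR (al * word_time (mkseq u N)).
  move=> i; have [x xT xE] := word_trajectory A um m_gt0 (delta_mx i 0).
  have [C CP] := alT x xT; exists C => N; rewrite -xE; apply: CP.
  rewrite /word_time big_map big_seq sumr_ge0// => k _.
  by rewrite (le_trans (ltW m_gt0)).
pose k := Num.bound `|\sum_i c i|.
have [_ _ [y]] := fP (prefixes g k, k).
rewrite /= -/(g (prefixes g k) k) -/(prefixes g k.+1) uE.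
set N := size _; set P := word_op A _.
apply/negP; rewrite -leNgt.
rewrite (le_trans (seminorm_le_basis y (seminorm_mulmx P)))// ler_wpM2r//.
apply: (@le_trans _ _ (\sum_i c i * expR (al * word_time (mkseq u N)))).
  by apply: ler_sum => i _; exact: cP.
rewrite -mulr_suml ler_wpM2r ?expR_ge0//.
by rewrite (le_trans (ler_norm _))// (ltW (archi_boundP (normr_ge0 _))).
Qed.

(** Preceded by a stay of length [m] at its first vertex, a discrete trajectory
    is a word: an edge to another vertex opens a stay and a loop prolongs the
    current one. *)
Lemma discrete_word (R : realType) (d n : nat) (A : 'I_n -> 'M[R]_d) (m h : R)
    v x k : 0 < h -> discrete_trajectory A m h v x ->
  exists w, [/\ word_admissible m w,
    word_time w = path_time m h v k + m &
    x k = word_op A w *m (mexp (- m *: A (v 0%N)) *m x 0%N)].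
Proof.
move=> h_gt0 vx.
suff [w [s [wm wt wx]]] : exists w s, [/\ word_admissible m (rcons w (v k, s)),
    word_time (rcons w (v k, s)) = path_time m h v k + m &
    x k = word_op A (rcons w (v k, s)) *m (mexp (- m *: A (v 0%N)) *m x 0%N)].
  by exists (rcons w (v k, s)).
elim: k => [|k [w [s [wm wt wx]]]].
  exists [::], m; split; first by rewrite /= lexx.
    by rewrite /path_time big_ord0 add0r /word_time big_seq1.
  by rewrite /= mul1mx /stay_op mulmxA mexpVK mul1mx.
move: wm; rewrite /word_admissible all_rcons => /andP[/= sm wm].
rewrite path_timeS vx /edge_op /edge_time.
case: eqP => [vE|_].
  exists w, (s + h); split.
  - by rewrite all_rcons /= wm andbT (le_trans sm)// lerDl ltW.
  - rewrite word_time_rcons /= addrA -[w in LHS]/w.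
    by move: wt; rewrite word_time_rcons /= => ->; rewrite addrAC.
  - have E : mexp (h *: A (v k)) *m stay_op A (v k, s) = stay_op A (v k, s + h).
      by rewrite /stay_op /= -mexpD addrC.
    by rewrite wx !word_op_rcons !mulmxA vE E.
exists (rcons w (v k, s)), m; split.
- by rewrite !all_rcons /= lexx sm wm.
- by rewrite word_time_rcons wt.
- by rewrite wx [in RHS]word_op_rcons -[in RHS]mulmxA.
Qed.

Lemma path_growth_trajectory (R : realType) (d n : nat) (A : 'I_n -> 'M[R]_d)
    (m h al : R) : (0 < n)%N -> 0 < m -> 0 < h ->
  trajectory_growth A m al -> path_growth A m h al.
Proof.
move=> n0 m0 h0 alT; have [C CP] := word_uniform_bound n0 m0 alT.
have [M M0 AM] := family_bound A.
exists (`|C| * expR (al * m) * expR (M * m)) => v x vx k.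
have [w [wm wt ->]] := discrete_word k h0 vx.
rewrite (le_trans (CP w wm _))// wt mulrDr expRD.
have := mexp_scale_below (- m) M0 (AM (v 0%N)) (x 0%N).
rewrite normrN gtr0_norm//.
move=> /(ler_wpM2l (mulr_ge0 (normr_ge0 C) (mulr_ge0 (expR_ge0
  (al * path_time m h v k)) (expR_ge0 (al * m))))) h1.
rewrite (le_trans _ (le_trans h1 _))//.
  by rewrite ler_wpM2r// ler_wpM2r ?ler_norm// mulr_ge0// expR_ge0.
by rewrite le_eqVlt; apply/orP; left; apply/eqP; ring.
Qed.

(** * Interpolation between the points of the grid *)

(** The odd terms of the two Taylor expansions of order three cancel. *)
Lemma mexp_second_difference (R : realType) (d : nat) (X : 'M[R]_d) (c de : R)
    (x : 'cV[R]_d) : 0 <= c -> acts_below X c -> 0 <= de <= 1 ->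
  `|mexp (de *: X) *m x + mexp (- de *: X) *m x - 2 *: x
      - de ^+ 2 *: (X *m (X *m x))| <= 2 * c ^+ 3 * expR c * `|x| * de ^+ 3.
Proof.
move=> c0 Xc /andP[de0 de1].
have X2 : X ^+ 2 *m x = X *m (X *m x) by rewrite expr2 -mulmxE -mulmxA.
have taylor3 e : `|e| = de -> `|mexp (e *: X) *m x -
    (x + e *: (X *m x) + (e ^+ 2 / 2) *: (X *m (X *m x)))| <=
    c ^+ 3 * expR c * `|x| * de ^+ 3.
  move=> ee; have eX : acts_below (e *: X) (de * c).
    by move=> y; rewrite -scalemxAl normrZ ee -mulrA ler_wpM2l.
  have := mexp_taylor 3 x (mulr_ge0 de0 c0) eX.
  have -> : \sum_(0 <= k < 3) (k`!%:R)^-1 *: ((e *: X) ^+ k *m x) =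
      x + e *: (X *m x) + (e ^+ 2 / 2) *: (X *m (X *m x)).
    rewrite !big_nat_recr//= big_geq// add0r !scalemx_expr !expr0 expr1.
    rewrite !scale1r mul1mx -!scalemxAl X2 !scalerA.
    by rewrite !factS fact0 !muln1 invr1 !mul1r !scale1r [2^-1 * _]mulrC.
  move=> /le_trans; apply.
  rewrite [leLHS](_ : _ = (c ^+ 3 * `|x| * de ^+ 3) * expR (de * c)).
    rewrite [leRHS](_ : _ = (c ^+ 3 * `|x| * de ^+ 3) * expR c).
      by rewrite ler_wpM2l ?mulr_ge0 ?exprn_ge0// ler_expR ler_piMl.
    ring.
  ring.
have := lerD (taylor3 de (ger0_norm de0)) (taylor3 (- de) _).
rewrite normrN ger0_norm// => /(_ erefl).
move=> H; rewrite [leRHS](_ : _ = c ^+ 3 * expR c * `|x| * de ^+ 3 +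
  c ^+ 3 * expR c * `|x| * de ^+ 3); last by ring.
apply: le_trans H.
rewrite (le_trans _ (ler_normD _ _))// le_eqVlt; apply/orP; left; apply/eqP.
congr `|_|; rewrite sqrrN scaleNr; apply/matrixP => i j; rewrite !mxE.
by field.
Qed.

(** A maximum principle.  Were the maximum of [N (y s) - c s (h - s) / 2] interior,
    the symmetric second difference of [N o y] there would be at most [- c] per
    squared step, while [y'' = X (X y)] allows no less than [- K M]. *)
Lemma interpolation_step (R : realType) (d : nat) (N : 'cV[R]_d -> R)
    (X : 'M[R]_d) (h K M c : R) (x : 'cV[R]_d) :
  is_seminorm N -> 0 < h ->
  (forall y, N (X *m (X *m y)) <= K * N y) -> 0 <= K ->
  (forall y, N (mexp (h *: X) *m y) <= N y) ->
  (forall s, 0 <= s <= h -> N (mexp (s *: X) *m x) <= M) -> K * M < c ->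
  forall s, 0 <= s <= h -> N (mexp (s *: X) *m x) <= N x + c * h ^+ 2 / 8.
Proof.
move=> NN h0 XK K0 Xh XM KMc.
pose y s := mexp (s *: X) *m x.
pose psi s := N (y s) - c * (s * (h - s) / 2).
have M0 : 0 <= M.
  have := XM 0; rewrite lexx ltW// => /(_ isT); apply: le_trans.
  exact: seminorm_ge0.
have c0 : 0 <= c by rewrite (le_trans _ (ltW KMc))// mulr_ge0.
have psic : {within `[0, h], continuous psi}.
  apply: continuous_subspaceT => s; apply: cvgB.
    apply: (cvg_comp y N); last exact: seminorm_continuous.
    by apply: cvg_mulmx; [exact: continuous_mexp|exact: cvg_cst].
  apply: cvgMl_tmp; apply: cvgMr_tmp; apply: cvgM; first exact: cvg_id.
  by apply: cvgB; [exact: cvg_cst|exact: cvg_id].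
have [s1 s1h s1max] := EVT_max (ltW h0) psic.
suff psi1 : psi s1 <= N x.
  move=> s sh; have /s1max : s \in `[0, h]%R by rewrite in_itv.
  move=> /le_trans/(_ psi1); rewrite /psi lerBlDr => /le_trans; apply.
  rewrite lerD2l -[leRHS]mulrA ler_wpM2l//.
  by have := sqr_ge0 (h - 2 * s); nra.
move: s1h; rewrite in_itv /= => /andP[s10 s1h].
have [s1E|s1n0] := eqVneq s1 0.
  by rewrite /psi s1E /y scale0r mexp0 mul1mx mul0r mul0r mulr0 subr0.
have [s1E|s1nh] := eqVneq s1 h.
  by rewrite /psi s1E /y subrr mulr0 mul0r mulr0 subr0.
have {s10 s1n0}s10 : 0 < s1 by rewrite lt_def s1n0.
have {s1h s1nh}s1h : s1 < h by rewrite lt_def eq_sym s1nh.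
exfalso.
have [b b0 Xb] : exists2 b, 0 <= b & acts_below X b.
  by exists (d%:R * `|X|); [rewrite mulr_ge0|exact: acts_below_norm].
set D := \sum_i N (delta_mx i 0).
have D0 : 0 <= D by apply: sumr_ge0 => i _; exact: seminorm_ge0.
set L := D * (2 * b ^+ 3 * expR b * `|y s1|).
have L0 : 0 <= L by rewrite !mulr_ge0 ?exprn_ge0 ?expR_ge0.
(* The step is small enough to stay in the interval and to beat the third
   order error. *)
have [de [de0 des deh de1 deL]] : exists de : R,
    [/\ 0 < de, de <= s1, de <= h - s1, de <= 1 & L * de < c - K * M].
  exists (Num.min (Num.min s1 (h - s1)) (Num.min 1 ((c - K * M) / (2 * (L + 1))))).
  have e0 : 0 < (c - K * M) / (2 * (L + 1)).
    by rewrite divr_gt0 ?subr_gt0// mulr_gt0// ltr_wpDl.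
  set e := _ / _ in e0 *; split.
  - by rewrite !lt_min s10 subr_gt0 s1h ltr01 e0.
  - by rewrite !ge_min lexx.
  - by rewrite !ge_min lexx orbT.
  - by rewrite !ge_min lexx !orbT.
  - rewrite (@le_lt_trans _ _ (L * e))//.
      by rewrite ler_wpM2l// !ge_min lexx !orbT.
    rewrite /e mulrCA gtr_pMr ?subr_gt0// ltr_pdivrMr ?mul1r.
      lra.
    by rewrite mulr_gt0// ltr_wpDl.
have yD e : y (s1 + e) = mexp (e *: X) *m y s1.
  by rewrite /y addrC mexpD mulmxA.
have psip : psi (s1 + de) <= psi s1.
  by apply: s1max; rewrite in_itv /=; apply/andP; split; lra.
have psim : psi (s1 - de) <= psi s1.
  by apply: s1max; rewrite in_itv /=; apply/andP; split; lra.
have := mexp_second_difference (y s1) b0 Xb (_ : 0 <= de <= 1).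
rewrite (ltW de0) de1 => /(_ isT); rewrite -!yD.
set rho := _ - _ => rhoL.
have Nrho : N rho <= L * de ^+ 3.
  rewrite (le_trans (seminorm_le_basis _ NN))// /L -mulrA -/D.
  by rewrite ler_wpM2l.
have de20 : 0 <= de ^+ 2 := sqr_ge0 de.
have twice : 2 * N (y s1) <= N (y (s1 + de)) + N (y (s1 - de)) +
    de ^+ 2 * (K * N (y s1)) + N rho.
  have -> : 2 * N (y s1) = N (2 *: y s1) by case: NN => _ ->; rewrite ger0_norm.
  have -> : 2 *: y s1 = (y (s1 + de) + y (s1 - de)) +
      (- (de ^+ 2 *: (X *m (X *m y s1)))) + - rho.
    rewrite /rho; apply/matrixP => i j; rewrite !mxE; ring.
  rewrite (le_trans (NN.1 _ _))// seminormN// lerD2r.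
  rewrite (le_trans (NN.1 _ _))// seminormN// lerD//; first exact: NN.1.
  by case: (NN) => _ ->; rewrite (ger0_norm de20) ler_wpM2l.
have ys1 : N (y s1) <= M by apply: XM; rewrite !ltW.
have Kys1 : K * N (y s1) <= K * M by rewrite ler_wpM2l.
have key : c * de ^+ 2 <= de ^+ 2 * (K * M) + L * de ^+ 3.
  have := ler_wpM2l (exprn_ge0 2 (ltW de0)) Kys1.
  move: psip psim; rewrite /psi => ? ? ?.
  have -> : c * de ^+ 2 = 2 * (c * (s1 * (h - s1) / 2)) -
    c * ((s1 + de) * (h - (s1 + de)) / 2) - c * ((s1 - de) * (h - (s1 - de)) / 2).
    by field.
  lra.
have de2 : 0 < de ^+ 2 by rewrite exprn_gt0.
have : (c - K * M - L * de) * de ^+ 2 <= 0.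
  rewrite (_ : _ * _ = c * de ^+ 2 - (de ^+ 2 * (K * M) + L * de ^+ 3)).
    by rewrite subr_le0.
  by ring.
by rewrite pmulr_lle0// subr_le0 leNgt deL.
Qed.

(** The maximum [M] of [N (y s)] on a step of the grid satisfies
    [M <= N x + K M h ^ 2 / 8], by the maximum principle with [c] tending to
    [K M]; and the values at the points of the grid do not increase. *)
Lemma interpolation_bound (R : realType) (d : nat) (N : 'cV[R]_d -> R)
    (X : 'M[R]_d) (h K t : R) (x : 'cV[R]_d) :
  is_seminorm N -> 0 < h ->
  (forall y, N (X *m (X *m y)) <= K * N y) -> 0 <= K ->
  (forall y, N (mexp (h *: X) *m y) <= N y) ->
  K * h ^+ 2 / 8 < 1 -> 0 <= t ->
  N (mexp (t *: X) *m x) * (1 - K * h ^+ 2 / 8) <= N x.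
Proof.
move=> NN h0 XK K0 Xh q1 t0.
have short (z : 'cV[R]_d) s : 0 <= s <= h ->
    N (mexp (s *: X) *m z) * (1 - K * h ^+ 2 / 8) <= N z.
  pose f s := N (mexp (s *: X) *m z).
  have fc : {within `[0, h], continuous f}.
    apply: continuous_subspaceT => r.
    apply: (cvg_comp (fun r => mexp (r *: X) *m z) N); last exact: seminorm_continuous.
    by apply: cvg_mulmx; [exact: continuous_mexp|exact: cvg_cst].
  have [s0 s0h s0max] := EVT_max (ltW h0) fc.
  move=> sh; have q0 : 0 <= 1 - K * h ^+ 2 / 8 by rewrite subr_ge0 ltW.
  have fs : f s <= f s0 by apply: s0max; rewrite in_itv.
  rewrite (le_trans (ler_wpM2r q0 fs))// mulrBr mulr1 lerBlDr.
  apply/ler_addgt0Pr => e e0.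
  have fM r : 0 <= r <= h -> f r <= f s0 by move=> rh; apply: s0max; rewrite in_itv.
  have cK : K * f s0 < K * f s0 + e * 8 / h ^+ 2.
    by rewrite ltrDl divr_gt0 ?mulr_gt0 ?exprn_gt0.
  have s0h' : 0 <= s0 <= h by move: s0h; rewrite in_itv.
  have := interpolation_step NN h0 XK K0 Xh fM cK s0h'.
  move=> /le_trans; apply; rewrite le_eqVlt; apply/orP; left; apply/eqP.
  by field; rewrite gt_eqF.
have grid k : N (mexp ((k%:R * h) *: X) *m x) <= N x.
  elim: k => [|k IH]; first by rewrite mul0r scale0r mexp0 mul1mx.
  by rewrite -nat1r mulrDl mul1r mexpD -mulmxA (le_trans (Xh _)).
set k := Num.truncn (t / h).
have /andP[kt tk] : k%:R <= t / h < k.+1%:R.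
  by apply: truncn_itv; rewrite divr_ge0// ltW.
have sk : 0 <= t - k%:R * h <= h.
  move: kt tk; rewrite ler_pdivlMr// ltr_pdivrMr// -nat1r mulrDl mul1r => kt tk.
  by rewrite subr_ge0 kt lerBlDr ltW.
rewrite -(subrK (k%:R * h) t) mexpD -mulmxA (le_trans (short _ _ sk))//.
Qed.

(** * Growth of the trajectories in an extremal multinorm *)

Lemma trajectory_stay (R : realType) (d : nat) (X : 'M[R]_d)
    (x : R -> 'cV[R]_d) (a b : R) :
  0 <= a -> a <= b -> {within `[0, +oo[, continuous x} ->
  (forall t, a < t < b -> is_derive t 1 x (X *m x t)) ->
  x b = mexp ((b - a) *: X) *m x a.
Proof.
move=> a0 ab xc dx; apply: linear_ode_unique => // [i|t tab]; last first.
  by apply/velocityP; exact: dx.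
have xc' : {within `[a, b], continuous x}.
  apply: continuous_subspaceW xc => t /=; rewrite !in_itv /= => /andP[at_ _].
  by rewrite (le_trans a0).
move=> t; apply: (cvg_comp x (fun y : 'cV[R]_d => y i 0)); first exact: xc'.
exact: coord_continuous.
Qed.

Lemma multinorm_dominates (R : realType) (d n : nat)
    (N : 'I_n -> 'cV[R]_d -> R) :
  is_multinorm N -> exists2 D : R, 0 < D & forall j x, `|x| <= D * N j x.
Proof.
move=> NN; have /choice[D DP] : forall j, exists D : R,
    0 < D /\ forall x, `|x| <= D * N j x.
  by move=> j; have [D D0 DN] := norm_dominates (NN j); exists D.
have D0 : 0 <= \sum_j D j by apply: sumr_ge0 => j _; rewrite ltW// (DP j).1.
exists (\sum_j D j + 1); first by rewrite ltr_wpDl.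
move=> j x; rewrite (le_trans ((DP j).2 x))// ler_wpM2r//.
  exact/seminorm_ge0/norm_seminorm.
rewrite (bigD1 j)//= -addrA lerDl addr_ge0// sumr_ge0// => i _.
by rewrite ltW// (DP i).1.
Qed.

Lemma multinorm_bounded (R : realType) (d n : nat)
    (N : 'I_n -> 'cV[R]_d -> R) :
  is_multinorm N -> exists2 D : R, 0 <= D & forall j x, N j x <= D * `|x|.
Proof.
move=> NN; have NS j : is_seminorm (N j) by exact: norm_seminorm.
exists (\sum_j \sum_i N j (delta_mx i 0)).
  by apply: sumr_ge0 => j _; apply: sumr_ge0 => i _; exact: seminorm_ge0.
move=> j x; rewrite (le_trans (seminorm_le_basis x (NS j)))// ler_wpM2r//.
rewrite [leRHS](bigD1 j)//= lerDl sumr_ge0// => i _; apply: sumr_ge0 => k _.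
exact: seminorm_ge0.
Qed.

(** Because [(1 - q) (1 + q + 2 q ^ 2) = 1 + q ^ 2 (1 - 2 q)]. *)
Lemma geometric_le_expR (R : realType) (q : R) k : 0 <= q -> q <= 2^-1 ->
  1 <= (1 - q) ^+ k * expR ((q + 2 * q ^+ 2) * k%:R).
Proof.
move=> q0 q2; rewrite mulrC expRM_natr -exprMn exprn_ege1//.
have h := expR_ge1Dx (q + 2 * q ^+ 2).
have : 0 <= 1 - q by lra.
move=> /ler_wpM2r/(_ _ _ h); apply: le_trans.
have : 0 <= q ^+ 2 * (1 - 2 * q) by rewrite mulr_ge0 ?sqr_ge0//; lra.
nra.
Qed.

Section extremal_growth.
Context (R : realType) (d n : nat) (A : 'I_n -> 'M[R]_d) (m h sg K : R)
  (N : 'I_n -> 'cV[R]_d -> R).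
Hypotheses (m_gt0 : 0 < m) (h_gt0 : 0 < h) (K_ge0 : 0 <= K).
Hypothesis N_norm : is_multinorm N.
Hypothesis N_edge : forall i j x,
  N j (edge_op A m h j i *m x) <= expR (sg * edge_time m h j i) * N i x.
Let B j := A j - sg%:M.
Hypothesis K_bound : forall j x, N j (B j *m (B j *m x)) <= K * N j x.
Let q := K * h ^+ 2 / 8.
Hypothesis q_small : q <= 2^-1.

Let NS j : is_seminorm (N j). Proof. exact: norm_seminorm. Qed.

Let q_ge0 : 0 <= q.
Proof. by rewrite /q divr_ge0// mulr_ge0// exprn_ge0// ltW. Qed.

Let q_lt1 : q < 1. Proof. by have := q_small; lra. Qed.

Let edge_contracts i j x : N j (mexp (edge_time m h j i *: B j) *m x) <= N i x.
Proof.
have t0 := edge_time_gt0 j i m_gt0 h_gt0.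
rewrite mexp_shift ?(ltW t0)// -scalemxAl; case: (NS j) => _ ->.
rewrite ger0_norm ?expR_ge0// mulNr expRN ler_pdivrMl ?expR_gt0//.
by rewrite -edge_opE.
Qed.

(** A stay multiplies the norm by at most [1 / (1 - q)]: its first part, of
    length [m], is an edge, and the rest is interpolated between loops. *)
Lemma stay_bound i j t x : 0 <= t -> (i != j -> m <= t) ->
  N j (mexp (t *: B j) *m x) * (1 - q) <= N i x.
Proof.
move=> t0 ijt; have loop y : N j (mexp (h *: B j) *m y) <= N j y.
  by have := edge_contracts j j y; rewrite /edge_time eqxx.
have [ij|ij] := eqVneq i j.
  by rewrite ij; apply: interpolation_bound.
have mt := ijt ij.
have := edge_contracts i j x; rewrite /edge_time eq_sym (negbTE ij).
apply: le_trans; rewrite -(subrK m t) mexpD -mulmxA.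
by apply: interpolation_bound => //; rewrite subr_ge0.
Qed.

(** Up to the time [t] there are at most [t / m] complete stays, each of which
    costs a factor [1 / (1 - q) <= expR (q + 2 * q ^+ 2)]; the stay in progress
    costs a constant, which compares the norms at two vertices. *)
Lemma extremal_trajectory_growth :
  trajectory_growth A m (sg + (q + 2 * q ^+ 2) / m).
Proof.
move=> x [tau [S [[tau0 taum SA] xc dx]]].
have [j jP] := choice SA.
have tau_lt k : tau k < tau k.+1.
  by rewrite (lt_le_trans _ (taum k))// ltrDl.
have tau_ge k : m * k%:R <= tau k.
  elim: k => [|k IH]; first by rewrite mulr0 tau0.
  by rewrite (le_trans _ (taum k))// -natr1 mulrDr mulr1 lerD2r.
have tau_ge0 k : 0 <= tau k by rewrite (le_trans _ (tau_ge k))// mulr_ge0// ltW.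
pose z t := expR (- sg * t) *: x t.
have zE k t : tau k <= t <= tau k.+1 ->
    z t = mexp ((t - tau k) *: B (j k)) *m z (tau k).
  move=> /andP[kt tk]; have xt : x t = mexp ((t - tau k) *: A (j k)) *m x (tau k).
    apply: trajectory_stay => // s /andP[ks st].
    rewrite -(jP k s) ?(ltW ks) ?(lt_le_trans st)//.
    by apply: (dx k); rewrite ks (lt_le_trans st).
  rewrite mexp_shift ?subr_ge0// /z xt -scalemxAl -scalemxAr scalerA -expRD.
  by congr (expR _ *: _); ring.
(* The vertex left at the time [tau k]; there is none at the time [0]. *)
pose i k := j k.-1.
have zk k : N (i k) (z (tau k)) * (1 - q) ^+ k <= N (i 0%N) (z 0).
  elim: k => [|k IH]; first by rewrite expr0 mulr1 tau0.
  apply: le_trans IH; rewrite exprS mulrA ler_wpM2r ?exprn_ge0 ?subr_ge0 ?(ltW q_lt1)//.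
  rewrite (zE k (tau k.+1)) ?lexx ?(ltW (tau_lt k))//.
  apply: stay_bound; first by rewrite subr_ge0 ltW.
  by rewrite lerBrDl taum.
have [D1 D10 D1P] := multinorm_bounded N_norm.
have [D2 D20 D2P] := multinorm_dominates N_norm.
exists (D2 * D1 * D2 / (1 - q) * N (i 0%N) (z 0)) => t t0.
have [k /andP[kt tk]] : exists k, tau k <= t < tau k.+1.
  have ex : exists k, t < tau k.
    exists (Num.truncn (t / m)).+1; rewrite (lt_le_trans _ (tau_ge _))//.
    by rewrite -ltr_pdivrMl// mulrC truncnS_gt.
  case: (ex_minnP ex) => -[|k] tk kmin; first by rewrite ltNge tau0 t0 in tk.
  exists k; rewrite tk andbT leNgt; apply/negP => /kmin.
  by rewrite ltnn.
have q1 : 0 < 1 - q by rewrite subr_gt0.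
have zt : `|z t| <= D2 * D1 * D2 / (1 - q) * N (i k) (z (tau k)).
  rewrite (le_trans (D2P (j k) _))// -!mulrA ler_wpM2l ?(ltW D20)//.
  rewrite (zE k t) ?kt ?(ltW tk)//.
  have same : j k != j k -> m <= t - tau k by rewrite eqxx.
  have kt' : 0 <= t - tau k by rewrite subr_ge0.
  have := stay_bound (z (tau k)) kt' same.
  rewrite -ler_pdivlMr// => /le_trans; apply.
  rewrite [leRHS](_ : _ = D1 * (D2 * N (i k) (z (tau k))) / (1 - q)); last by ring.
  rewrite ler_wpM2r ?invr_ge0 ?(ltW q1)//.
  by rewrite (le_trans (D1P _ _))// ler_wpM2l.
set C := D2 * D1 * D2 / (1 - q) in zt *.
have C0 : 0 <= C by rewrite /C divr_ge0 ?(ltW q1)// !mulr_ge0 ?(ltW D20).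
have xz : x t = expR (sg * t) *: z t.
  by rewrite /z scalerA -expRD mulNr subrr expR0 scale1r.
rewrite xz normrZ ger0_norm ?expR_ge0//.
rewrite mulrDl expRD [leRHS]mulrCA ler_wpM2l ?expR_ge0//.
rewrite (le_trans zt)// -[leRHS]mulrA ler_wpM2l//.
have Nz0 : 0 <= N (i k) (z (tau k)) by exact: seminorm_ge0.
have g := geometric_le_expR k q_ge0 q_small.
rewrite -[leLHS]mulr1 (le_trans (ler_wpM2l Nz0 g))// mulrA.
apply: ler_pM => //; rewrite ?expR_ge0// ?mulr_ge0 ?exprn_ge0 ?(ltW q1)//.
rewrite ler_expR mulrAC -mulrA ler_wpM2l//.
  by rewrite addr_ge0// mulr_ge0// exprn_ge0.
by rewrite ler_pdivlMr// mulrC (le_trans (tau_ge k)).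
Qed.

End extremal_growth.

(** * Extremal multinorms for steps tending to zero *)

(** A subspace of maximal dimension inside [P]. *)
Lemma vspace_of_closed (F : fieldType) (V : vectType F) (P : V -> Prop) :
  P 0 -> (forall x y, P x -> P y -> P (x + y)) ->
  (forall a x, P x -> P (a *: x)) ->
  exists U : {vspace V}, forall x, x \in U <-> P x.
Proof.
move=> P0 PD PZ.
pose Q k := `[< exists2 U : {vspace V}, \dim U = k & forall x, x \in U -> P x >].
have exQ : exists k, Q k.
  exists 0%N; apply/asboolP; exists 0%VS; first exact: dimv0.
  by move=> x; rewrite memv0 => /eqP ->.
have bQ k : Q k -> (k <= \dim {:V})%N.
  by move=> /asboolP[U <- _]; apply/dimvS/subvf.
case: (ex_maxnP exQ bQ) => k /asboolP[U Uk UP] kmax.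
exists U => x; split; [exact: UP|move=> Px].
have UxP : forall y, y \in (U + <[x]>)%VS -> P y.
  move=> y /memv_addP[u /UP Pu [w /vlineP[a ->] ->]].
  by apply: PD => //; exact: PZ.
have Uxk : (\dim (U + <[x]>)%VS <= k)%N.
  by apply: kmax; apply/asboolP; exists (U + <[x]>)%VS.
have /eqP -> : U == (U + <[x]>)%VS by rewrite eqEdim addvSl Uk.
apply/memv_addP; exists 0; first exact: mem0v.
by exists x; rewrite ?memv_line ?add0r.
Qed.

Lemma acts_below_scale (R : realType) (d : nat) (X : 'M[R]_d) (M t : R) :
  acts_below X M -> acts_below (t *: X) (`|t| * M).
Proof. by move=> XM x; rewrite -scalemxAl normrZ -mulrA ler_wpM2l. Qed.

(** [nu l i] stands for the extremal norm at the vertex [i] for the step [h l],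
    divided by a common factor for all [i].  In the limit the loops of length
    [h l] generate the flows of the [A i], so that the kernels of the limit
    seminorms are invariant under these flows. *)
Section limit_kernels.
Context (R : realType) (d n : nat) (A : 'I_n -> 'M[R]_d) (m M : R)
  (U : set_system nat) (h : nat -> R) (nu : nat -> 'I_n -> 'cV[R]_d -> R).
Hypotheses (UU : UltraFilter U) (M_ge0 : 0 <= M).
Hypothesis A_bound : forall j, acts_below (A j) M.
Hypotheses (h_gt0 : forall l, 0 < h l) (h_le1 : forall l, h l <= 1)
  (h_cvg : h @ U --> 0).
Hypothesis nuS : forall l i, is_seminorm (nu l i).
Hypothesis nu_le : forall l i x, nu l i x <= `|x|.
Hypothesis nu_sum : forall l, \sum_i \sum_b nu l i (delta_mx b 0) = 1.
Hypothesis nu_loop : forall l i x,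
  nu l i (mexp (h l *: A i) *m x) <= expR (M * h l) * nu l i x.
Hypothesis nu_jump : forall l i j x, i != j ->
  nu l i (mexp (m *: A i) *m x) <= expR (M * m) * nu l j x.

Let ker i (x : 'cV[R]_d) : Prop := (fun l => nu l i x) @ U --> 0.

Let ker_le i x (g : nat -> R) : (forall l, nu l i x <= g l) -> g @ U --> 0 ->
  ker i x.
Proof.
move=> gx g0; apply: (@squeeze_cvgr _ _ _ _ (fun=> 0) g); last exact: g0.
  by apply: nearW => l; rewrite gx andbT; exact: seminorm_ge0.
exact: cvg_cst.
Qed.

Let ker0 i : ker i 0.
Proof.
apply: (ker_le (g := fun=> 0)) => [l|]; last exact: cvg_cst.
by rewrite seminorm0.
Qed.

Let kerD i x y : ker i x -> ker i y -> ker i (x + y).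
Proof.
move=> kx ky; apply: (ker_le (g := fun l => nu l i x + nu l i y)) => [l|].
  by case: (nuS l i).
by rewrite -(addr0 0); exact: cvgD.
Qed.

Let kerZ i a x : ker i x -> ker i (a *: x).
Proof.
move=> kx; apply: (ker_le (g := fun l => `|a| * nu l i x)) => [l|].
  by case: (nuS l i) => _ ->.
by rewrite -(mulr0 `|a|); exact: cvgMl_tmp.
Qed.

Let ker_closed i x :
  (forall e : R, 0 < e -> exists2 y, ker i y & `|x - y| <= e) -> ker i x.
Proof.
move=> xP; apply/cvgrPdist_le => e e0.
have [y ky xy] := xP (e / 2) (divr_gt0 e0 (ltr0n _ 2)).
have e20 : 0 < e / 2 by rewrite divr_gt0.
near=> l; rewrite sub0r normrN ger0_norm ?seminorm_ge0//.
rewrite (le_trans (seminorm_sub x y (nuS l i)))// [leRHS]splitr lerD//.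
  rewrite -[leLHS]ger0_norm ?seminorm_ge0// -normrN -sub0r.
  by near: l; move/cvgrPdist_le : ky; exact.
by rewrite (le_trans (nu_le _ _ _)).
Unshelve. all: by end_near. Qed.

Let nu_loops l i k x :
  nu l i (mexp ((k%:R * h l) *: A i) *m x) <= expR (M * (k%:R * h l)) * nu l i x.
Proof.
elim: k => [|k IH]; first by rewrite mul0r scale0r mexp0 mulr0 expR0 mul1r mul1mx.
rewrite -nat1r mulrDl mul1r mexpD -mulmxA (le_trans (nu_loop _ _ _))//.
by rewrite mulrDr expRD -mulrA ler_wpM2l ?expR_ge0.
Qed.

(** A time [t] is a number of loops up to an error below [h l], and the loops
    can be taken last. *)
Let ker_flow i x t : 0 <= t -> ker i x -> ker i (mexp (t *: A i) *m x).
Proof.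
move=> t0 kx.
apply: (ker_le (g := fun l => expR (M * t) * (nu l i x + h l * (M * expR M * `|x|)))).
  move=> l; set k := Num.truncn (t / h l).
  have /andP[kt tk] : k%:R <= t / h l < k.+1%:R.
    by apply: truncn_itv; rewrite divr_ge0// ltW.
  move: kt tk; rewrite ler_pdivlMr// ltr_pdivrMr// -nat1r mulrDl mul1r => kt tk.
  set s := t - k%:R * h l; have s0 : 0 <= s by rewrite subr_ge0.
  have sh : s <= h l by rewrite lerBlDr ltW.
  have -> : t = k%:R * h l + s by rewrite subrKC.
  rewrite mexpD -mulmxA (le_trans (nu_loops _ _ _ _))//.
  apply: ler_pM; rewrite ?expR_ge0 ?seminorm_ge0//.
    by rewrite ler_expR ler_wpM2l// lerDl.
  rewrite (le_trans (seminorm_sub _ x (nuS l i)))// lerD2l.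
  rewrite (le_trans (nu_le _ _ _))//.
  have sM : acts_below (s *: A i) (s * M).
    by have := acts_below_scale s (A_bound i); rewrite ger0_norm.
  have := mexp_taylor 1 x (mulr_ge0 s0 M_ge0) sM.
  rewrite big_nat1 expr0 mul1mx fact0 invr1 scale1r => /le_trans; apply.
  rewrite expr1 -!mulrA ler_pM ?mulr_ge0 ?expR_ge0//.
  rewrite ler_wpM2l// ler_wpM2r// ler_expR ler_piMl// (le_trans sh)//.
rewrite -(mulr0 (expR (M * t))); apply: cvgMl_tmp.
rewrite -(addr0 0); apply: cvgD => //.
by rewrite -[X in _ --> X](mul0r (M * expR M * `|x|)); exact: cvgMr_tmp.
Qed.

Let ker_mulmx i x : ker i x -> ker i (A i *m x).
Proof.
move=> kx; apply: ker_closed => e e0.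
pose C := M ^+ 2 * expR M * `|x| + 1.
have C0 : 0 < C by rewrite ltr_wpDl// !mulr_ge0 ?exprn_ge0 ?expR_ge0.
pose t := Num.min 1 (e / C).
have t0 : 0 < t by rewrite lt_min ltr01 divr_gt0.
have t1 : t <= 1 by rewrite ge_min lexx.
have te : t * C <= e by rewrite -ler_pdivlMr// ge_min lexx orbT.
exists (t^-1 *: (mexp (t *: A i) *m x - x)).
  apply: kerZ; apply: kerD; first exact: ker_flow (ltW t0) kx.
  by rewrite -scaleN1r; exact: kerZ.
have tM : acts_below (t *: A i) (t * M).
  by have := acts_below_scale t (A_bound i); rewrite ger0_norm ?ltW.
have := mexp_taylor 2 x (mulr_ge0 (ltW t0) M_ge0) tM.
rewrite !big_nat_recr//= big_geq// add0r expr0 expr1 mul1mx fact0 invr1 !scale1r.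
rewrite -scalemxAl => H.
have -> : A i *m x - t^-1 *: (mexp (t *: A i) *m x - x) =
    - (t^-1 *: (mexp (t *: A i) *m x - (x + t *: (A i *m x)))).
  move: (mexp _ *m x) (A i *m x) => y z; apply/matrixP => a b; rewrite !mxE.
  by field; rewrite gt_eqF.
rewrite normrN normrZ gtr0_norm ?invr_gt0// ler_pdivrMl//.
rewrite (le_trans H)// (le_trans _ (ler_wpM2l (ltW t0) te))//.
rewrite [leLHS](_ : _ = t ^+ 2 * (M ^+ 2 * expR (t * M) * `|x|)); last by ring.
rewrite [leRHS]mulrA -[t * t]expr2 ler_wpM2l ?exprn_ge0 ?(ltW t0)//.
rewrite (le_trans (_ : _ <= M ^+ 2 * expR M * `|x|)) ?lerDl//.
rewrite ler_wpM2r// ler_wpM2l ?exprn_ge0// ler_expR.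
by rewrite ler_piMl.
Qed.

Let ker_mexp i x t : ker i x -> ker i (mexp (t *: A i) *m x).
Proof.
move=> kx; apply: ker_closed => e e0.
pose s := series (fun k : nat => (k`!%:R)^-1 *: (t *: A i) ^+ k).
have : (fun l => s l *m x) @ \oo --> mexp (t *: A i) *m x.
  by apply: cvg_mulmx; [exact: cvg_mexp|exact: cvg_cst].
move=> /cvgrPdist_le/(_ e e0) => near_s.
have [l le] := filter_ex near_s; exists (s l *m x) => //.
rewrite /s /series /= mulmx_suml; 
apply: (big_ind (ker i)) => [||k _]; [exact: ker0|exact: kerD|].
rewrite scalemx_expr scalerA -scalemxAl; apply: kerZ.
elim: k => [|k IH]; first by rewrite expr0 mul1mx.
by rewrite exprS -mulmxE -mulmxA; exact: ker_mulmx.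
Qed.

(** The edge to [i] maps the kernel at [j] into the kernel at [i], which is
    invariant under the inverse of that edge. *)
Let ker_sub i j x : ker j x -> ker i x.
Proof.
move=> kx; have [->//|ij] := eqVneq i j.
have : ker i (mexp (m *: A i) *m x).
  apply: (ker_le (g := fun l => expR (M * m) * nu l j x)) => [l|].
    exact: nu_jump.
  by rewrite -(mulr0 (expR (M * m))); exact: cvgMl_tmp.
by move=> /(@ker_mexp i _ (- m)); rewrite mulmxA mexpKV mul1mx.
Qed.

Lemma limit_kernel_trivial i x : irreducible_family A ->
  (fun l => nu l i x) @ U --> 0 -> x = 0.
Proof.
move=> irr kx; have [V VP] := vspace_of_closed (@ker0 i) (@kerD i) (@kerZ i).
have [] := irr V.
- move=> j y /VP ky; apply/VP; apply: ker_sub (ker_mulmx _).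
  exact: ker_sub ky.
- by move=> V0; move/VP : kx; rewrite V0 memv0 => /eqP.
- move=> Vf; have kf j y : ker j y.
    by apply: (@ker_sub j i); apply/VP; rewrite Vf memvf.
  have : (fun l => \sum_j \sum_b nu l j (delta_mx b 0)) @ U -->
      \sum_(j < n) \sum_(b < d) (0 : R).
    apply: cvg_big => [|j _]; first exact: add_continuous.
    by apply: cvg_big => [|b _]; [exact: add_continuous|exact: kf].
  under eq_fun do rewrite nu_sum.
  rewrite !big1// => h0; have h1 : (fun=> 1 : R) @ U --> (1 : R) by exact: cvg_cst.
  have E : 0 = 1 :> R := cvg_unique (@norm_hausdorff _ _) h0 h1.
  by move: (oner_neq0 R); rewrite -E eqxx.
Qed.

End limit_kernels.

Lemma extremal_edge (R : realType) (d n : nat) (A : 'I_n -> 'M[R]_d) (m h : R)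
    (N : 'I_n -> 'cV[R]_d -> R) :
  (0 < d)%N -> (0 < n)%N -> 0 < m -> 0 < h -> extremal_multinorm A m h N ->
  forall i j x, N j (edge_op A m h j i *m x) <=
    expR (sigma_discr A m h * edge_time m h j i) * N i x.
Proof.
move=> d0 n0 m0 h0 [_ NE] i j x; have [M M0 AM] := family_bound A.
have [jE _ _] := jsr_growth m0 h0 M0 AM d0 n0.
have := NE i j x; rewrite jE /powR gt_eqF ?expR_gt0// expRK.
by rewrite [_ * sigma_discr _ _ _]mulrC.
Qed.

(** Unboundedness along a sequence of steps gives unit vectors on which the
    normalized extremal norms tend to zero, hence a nonzero vector in the kernel
    of a limit seminorm, against irreducibility. *)
Lemma extremal_curvature_bounded (R : realType) (d n : nat)
    (A : 'I_n -> 'M[R]_d) (m : R) (N : R -> 'I_n -> 'cV[R]_d -> R) :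
  (0 < d)%N -> (0 < n)%N -> 0 < m -> irreducible_family A ->
  (\forall h \near (0 : R)^'+, extremal_multinorm A m h (N h)) ->
  forall j, exists2 K : R, 0 <= K & \forall h \near (0 : R)^'+, forall x,
    N h j ((A j - (sigma_discr A m h)%:M) ^+ 2 *m x) <= K * N h j x.
Proof.
move=> d0 n0 m0 irr Next j; apply: contrapT => noK.
have [M M0 AM] := family_bound A.
pose B h := A j - (sigma_discr A m h)%:M.
have /choice[h hP] : forall l : nat, exists h : R,
    [/\ 0 < h, h < l.+1%:R^-1, extremal_multinorm A m h (N h) &
     exists x, l.+1%:R * N h j x < N h j (B h ^+ 2 *m x)].
  move=> l; apply: contrapT => noh; apply: noK; exists l.+1%:R => //.
  near=> h => x; rewrite leNgt; apply/negP => hx; apply: noh; exists h; split.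
  - by near: h; exact: nbhs_right_gt.
  - by near: h; apply: nbhs_right_lt; rewrite invr_gt0.
  - by near: h; exact: Next.
  - by exists x.
have h0 l : 0 < h l by have [] := hP l.
have h1 l : h l <= 1.
  by have [_ /ltW hl _ _] := hP l; rewrite (le_trans hl)// invf_le1// ler1n.
have Nn l i : is_norm (N (h l) i) by have [_ _ []] := hP l.
have NS l i := norm_seminorm (Nn l i).
have /choice[x xP] : forall l, exists x : 'cV[R]_d,
    l.+1%:R * N (h l) j x < N (h l) j (B (h l) ^+ 2 *m x).
  by move=> l; have [] := hP l.
have x0 l : 0 < `|x l|.
  rewrite normr_gt0; apply/eqP => xl0; have := xP l.
  by rewrite xl0 mulmx0 seminorm0// mulr0 ltxx.
pose s l := \sum_i \sum_b N (h l) i (delta_mx b 0).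
have s0 l : 0 < s l.
  have ge0 i : 0 <= \sum_b N (h l) i (delta_mx b 0).
    by apply: sumr_ge0 => b _; exact: seminorm_ge0.
  rewrite /s (bigD1 (Ordinal n0))//= ltr_pwDl ?sumr_ge0//.
  rewrite (bigD1 (Ordinal d0))//= ltr_pwDl ?sumr_ge0//; last first.
    by move=> b _; exact: seminorm_ge0.
  rewrite lt_def seminorm_ge0// andbT; apply/eqP; case: (Nn l (Ordinal n0)) => _ _.
  move=> /(_ (delta_mx (Ordinal d0) 0)) h' /h' /matrixP/(_ (Ordinal d0) 0).
  by rewrite !mxE !eqxx => /eqP; rewrite oner_eq0.
pose nu l i y := N (h l) i y / s l.
have nuS l i : is_seminorm (nu l i).
  case: (NS l i) => ND NZ; split=> [y z|a y]; rewrite /nu.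
    by rewrite -mulrDl ler_wpM2r ?invr_ge0 ?ND// ltW.
  by rewrite NZ mulrA.
have nu_le l i y : nu l i y <= `|y|.
  rewrite /nu ler_pdivrMr// mulrC (le_trans (seminorm_le_basis y (NS l i)))//.
  rewrite ler_wpM2r// /s [leRHS](bigD1 i)//= lerDl sumr_ge0// => k _.
  by apply: sumr_ge0 => b _; exact: seminorm_ge0.
have nu_sum l : \sum_i \sum_b nu l i (delta_mx b 0) = 1.
  rewrite -(mulfV (lt0r_neq0 (s0 l))) /s mulr_suml; apply: eq_bigr => i _.
  by rewrite mulr_suml.
have sgM l : `|sigma_discr A m (h l)| <= M.
  by have [] := jsr_growth m0 (h0 l) M0 AM d0 n0.
have edge l i k y : nu l i (edge_op A m (h l) i k *m y) <=
    expR (M * edge_time m (h l) i k) * nu l k y.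
  rewrite /nu mulrA ler_wpM2r ?invr_ge0 ?(ltW (s0 l))//.
  have [_ _ Ne _] := hP l.
  rewrite (le_trans (extremal_edge d0 n0 m0 (h0 l) Ne k i y))//.
  rewrite ler_wpM2r ?seminorm_ge0// ler_expR ler_wpM2r//.
    by rewrite ltW// edge_time_gt0.
  by rewrite (le_trans (ler_norm _)).
have nu_loop l i y :
    nu l i (mexp (h l *: A i) *m y) <= expR (M * h l) * nu l i y.
  by have := edge l i i y; rewrite edge_opE /edge_time eqxx.
have nu_jump l i k y : i != k ->
    nu l i (mexp (m *: A i) *m y) <= expR (M * m) * nu l k y.
  by move=> ik; have := edge l i k y; rewrite edge_opE /edge_time (negbTE ik).
have [U [UU oU]] := ultraFilterLemma (F := \oo) _.
have hU : h @ U --> 0.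
  apply: cvg_trans (cvg_app _ oU) _.
  apply: (@squeeze_cvgr _ _ _ _ (fun=> 0) (@harmonic R)).
  - by apply: nearW => l; have [/ltW -> /ltW -> _ _] := hP l.
  - exact: cvg_cst.
  - exact: cvg_harmonic.
pose y l := `|x l|^-1 *: x l.
have y1 l : `|y l| = 1 by rewrite normrZ normfV normr_id mulVf// gt_eqF.
have BM l : acts_below (B (h l)) (2 * M).
  move=> z; rewrite /B mulmxBl mul_scalar_mx (le_trans (ler_normB _ _))//.
  by rewrite normrZ mulrDl mul1r mulrDl lerD ?AM// ler_wpM2r.
have nuy : (fun l => nu l j (y l)) @ U --> 0.
  apply: cvg_trans (cvg_app _ oU) _.
  apply: (@squeeze_cvgr _ _ _ _ (fun=> 0) (fun l => (2 * M) ^+ 2 * @harmonic R l)).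
  - apply: nearW => l; rewrite seminorm_ge0//= /harmonic /= mulrC ler_pdivlMl//.
    have : l.+1%:R * nu l j (x l) <= (2 * M) ^+ 2 * `|x l|.
      rewrite (le_trans _ (acts_below_expr 2 (mulr_ge0 _ M0) (BM l) (x l)))//.
      rewrite (le_trans _ (nu_le l j _))// /nu mulrA ler_wpM2r ?invr_ge0 ?(ltW (s0 l))//.
      exact/ltW/xP.
    rewrite -ler_pdivrMr// -mulrA => /(le_trans _); apply.
    by case: (nuS l j) => _ ->; rewrite normfV normr_id [X in _ * X]mulrC.
  - exact: cvg_cst.
  - by rewrite -(mulr0 ((2 * M) ^+ 2)); apply: cvgMl_tmp; exact: cvg_harmonic.
have nu_le1 l z : nu l j z <= 1 * `|z| by rewrite mul1r.
have [z z0 nuz] := ultra_null_vector UU (fun l => nuS l j) nu_le1 y1 nuy.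
move: z0; rewrite (_ : z = 0) ?eqxx//.
exact: (@limit_kernel_trivial _ _ _ A m M U h nu UU M0 AM h0 h1 hU nuS nu_le
  nu_sum nu_loop nu_jump j z irr nuz).
Unshelve. all: by end_near. Qed.

Lemma op_norm_bound (R : realType) (d : nat) (N : 'cV[R]_d -> R)
    (X : 'M[R]_d) (K : R) : is_norm N -> 0 <= K ->
  (forall x, N (X *m x) <= K * N x) ->
  [/\ 0 <= op_norm N X, op_norm N X <= K &
      forall x, N (X *m x) <= op_norm N X * N x].
Proof.
move=> NN K0 NX; have NS := norm_seminorm NN.
have ub : ubound [set N (X *m x) | x in [set x : 'cV[R]_d | N x = 1]] K.
  by move=> _ [x /= x1 <-]; rewrite (le_trans (NX x))// x1 mulr1.
have ge x : N x = 1 -> N (X *m x) <= op_norm N X.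
  by move=> x1; apply: ub_le_sup; [exists K|exists x].
have NX0 x : 0 <= N (X *m x) by exact: seminorm_ge0.
have empty : ~ (exists x, N x = 1) -> op_norm N X = 0.
  move=> no; rewrite /op_norm [X in sup X](_ : _ = set0) ?sup0//.
  by rewrite -subset0 => y [x x1 _]; apply: no; exists x.
split.
- have [[x x1]|no] := pselect (exists x, N x = 1).
    exact: le_trans (ge x x1).
  by rewrite empty.
- have [[x x1]|no] := pselect (exists x, N x = 1).
    by apply: ge_sup => //; exists (N (X *m x)), x.
  by rewrite empty.
- move=> x; have [Nx0|Nx0] := eqVneq (N x) 0.
    by rewrite Nx0 mulr0 (le_trans (NX x))// Nx0 mulr0.
  have Nx : 0 < N x by rewrite lt_def Nx0 seminorm_ge0.
  case: (NS) => _ NZ; have := ge ((N x)^-1 *: x); rewrite NZ gtr0_norm ?invr_gt0//.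
  rewrite mulVf// => /(_ erefl); rewrite -scalemxAr NZ gtr0_norm ?invr_gt0//.
  by rewrite mulrC ler_pdivrMr.
Qed.

Lemma shifted_square_norm_bound (R : realType) (d n : nat)
    (A : 'I_n -> 'M[R]_d) (s K : R) (N : 'I_n -> 'cV[R]_d -> R) :
  is_multinorm N -> 0 <= K ->
  (forall j x, N j ((A j - s%:M) ^+ 2 *m x) <= K * N j x) ->
  [/\ 0 <= shifted_square_norm A s N, shifted_square_norm A s N <= K &
      forall j x, N j ((A j - s%:M) *m ((A j - s%:M) *m x)) <=
        shifted_square_norm A s N * N j x].
Proof.
move=> NN K0 NK; have opb j := op_norm_bound (NN j) K0 (NK j).
split.
- exact: bigmax_ge_id.
- by apply: bigmax_le => // j _; have [] := opb j.
- move=> j x; have [_ _ /(_ x)] := opb j.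
  rewrite expr2 -mulmxE -mulmxA => /le_trans; apply.
  rewrite ler_wpM2r//; first exact/seminorm_ge0/norm_seminorm.
  exact: (le_bigmax _ _ j).
Qed.

Theorem corollary7 (R : realType) (d n : nat) (A : 'I_n -> 'M[R]_d) (m : R)
    (N : R -> 'I_n -> 'cV[R]_d -> R)
    (d_gt0 : (0 < d)%N) (n_gt0 : (0 < n)%N) (m_gt0 : 0 < m)
    (A_irr : irreducible_family A)
    (N_ext : \forall h \near (0 : R)^'+, extremal_multinorm A m h (N h)) :
  (forall h : R, 0 < h -> sigma_discr A m h <= lyapunov_exponent A m) /\
  exists r : R -> R,
    r =O_ ((0 : R)^'+) (fun h : R => h ^+ 4) /\
    \forall h \near (0 : R)^'+,
      lyapunov_exponent A m <=
        sigma_discr A m h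
        + shifted_square_norm A (sigma_discr A m h) (N h) / (8 * m) * h ^+ 2
        + r h.
Proof.
have [M M0 AM] := family_bound A.
have low h al : 0 < h -> trajectory_growth A m al -> sigma_discr A m h <= al.
  move=> h0 /(path_growth_trajectory n_gt0 m_gt0 h0).
  by have [_ _] := jsr_growth m_gt0 h0 M0 AM d_gt0 n_gt0; apply.
have /choice[K KP] : forall j, exists K : R, 0 <= K /\
    \forall h \near (0 : R)^'+, forall x,
    N h j ((A j - (sigma_discr A m h)%:M) ^+ 2 *m x) <= K * N h j x.
  move=> j; have [K K0 KN] :=
    extremal_curvature_bounded d_gt0 n_gt0 m_gt0 A_irr N_ext j.
  by exists K.
pose C := \sum_j K j.
have C0 : 0 <= C by apply: sumr_ge0 => j _; exact: (KP j).1.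
pose Kh h := shifted_square_norm A (sigma_discr A m h) (N h).
have KhP : \forall h \near (0 : R)^'+, [/\ 0 <= Kh h, Kh h <= C & forall j x,
    N h j ((A j - (sigma_discr A m h)%:M) *m
      ((A j - (sigma_discr A m h)%:M) *m x)) <= Kh h * N h j x].
  have allK : \forall h \near (0 : R)^'+, forall j x,
      N h j ((A j - (sigma_discr A m h)%:M) ^+ 2 *m x) <= K j * N h j x.
    by apply: filter_forall => j; exact: (KP j).2.
  near=> h; have [NN _] : extremal_multinorm A m h (N h) by near: h; exact: N_ext.
  apply: shifted_square_norm_bound => // j x.
  have /(_ j x) : forall j x, N h j ((A j - (sigma_discr A m h)%:M) ^+ 2 *m x) <=
    K j * N h j x by near: h; exact: allK.
  move=> /le_trans; apply; rewrite ler_wpM2r//.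
    exact/seminorm_ge0/norm_seminorm.
  by rewrite /C (bigD1 j)//= lerDl sumr_ge0// => i _; exact: (KP i).1.
pose q h := Kh h * h ^+ 2 / 8.
have growth : \forall h \near (0 : R)^'+,
    trajectory_growth A m (sigma_discr A m h + (q h + 2 * q h ^+ 2) / m).
  near=> h; have h0 : 0 < h by near: h; exact: nbhs_right_gt.
  have [Kh0 KhC KhN] : [/\ 0 <= Kh h, Kh h <= C & forall j x,
    N h j ((A j - (sigma_discr A m h)%:M) *m
      ((A j - (sigma_discr A m h)%:M) *m x)) <= Kh h * N h j x].
    by near: h; exact: KhP.
  have ext : extremal_multinorm A m h (N h) by near: h; exact: N_ext.
  apply: extremal_trajectory_growth => //; first by case: ext.
    exact: extremal_edge.
  have h1 : h <= 1 by near: h; apply: nbhs_right_le.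
  (* This makes [q h] at most [1 / 8]. *)
  have hC : h <= (C + 1)^-1.
    by near: h; apply: nbhs_right_le; rewrite invr_gt0 ltr_wpDl.
  have hCC : h * (C + 1) <= 1 by rewrite -ler_pdivlMr ?div1r// ltr_wpDl.
  have : Kh h * h ^+ 2 <= 1.
    rewrite (le_trans (ler_wpM2r (sqr_ge0 _) KhC))//.
    have : C * h <= 1 by rewrite (le_trans _ hCC)// mulrC ler_wpM2l ?(ltW h0)// lerDl.
    by move=> Ch; rewrite expr2 mulrA mulr_ile1// ?mulr_ge0 ?(ltW h0).
  by move=> ?; lra.
split=> [h h0|].
  have [al alP] := @filter_ex _ _ (at_right_proper_filter 0) _ growth.
  by apply: lb_le_inf => [|be]; [eexists; exact: alP|exact: low].
(* The second half of the exponent [(q h + 2 * q h ^+ 2) / m]. *)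
exists (fun h => 2 * q h ^+ 2 / m); split.
  apply/eqO_exP; exists (C ^+ 2 / m + 1).
    by rewrite ltr_wpDl// divr_ge0 ?sqr_ge0 ?ltW.
  near=> h; have h0 : 0 < h by near: h; exact: nbhs_right_gt.
  have [Kh0 KhC _] : [/\ 0 <= Kh h, Kh h <= C & forall j x,
    N h j ((A j - (sigma_discr A m h)%:M) *m
      ((A j - (sigma_discr A m h)%:M) *m x)) <= Kh h * N h j x].
    by near: h; exact: KhP.
  rewrite !ger0_norm ?exprn_ge0 ?(ltW h0)//; last first.
    by rewrite divr_ge0 ?(ltW m_gt0)// mulr_ge0// sqr_ge0.
  rewrite [leLHS](_ : _ = (Kh h ^+ 2 / 32 / m) * h ^+ 4); last first.
    by rewrite /q; field; rewrite gt_eqF.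
  rewrite ler_wpM2r ?exprn_ge0 ?(ltW h0)// (le_trans (_ : _ <= C ^+ 2 / m)) ?lerDl//.
  rewrite ler_wpM2r ?invr_ge0 ?(ltW m_gt0)//.
  have : Kh h ^+ 2 <= C ^+ 2 by rewrite lerXn2r.
  by have := sqr_ge0 (Kh h); lra.
near=> h; have h0 : 0 < h by near: h; exact: nbhs_right_gt.
have gh : trajectory_growth A m (sigma_discr A m h + (q h + 2 * q h ^+ 2) / m).
  by near: h; exact: growth.
rewrite [leRHS](_ : _ = sigma_discr A m h + (q h + 2 * q h ^+ 2) / m); last first.
  by rewrite /q /Kh; field; rewrite gt_eqF.
apply: ge_inf => //; exists (sigma_discr A m h) => be; exact: low.
Unshelve. all: by end_near. Qed.
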